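(* Let $V\in\mathbb{C}^{n\times k_0}$, $A\in\mathbb{C}^{n\times k}$ and $P\in\mathbb{C}^{k_0\times k_0}$, where $k_0+k\ll n$, be the (floating-point) data of the two-stage Householder-QR algorithm described in the context, executed in floating-point arithmetic under the rounding model and assumptions described there, with computed outputs $\hat Q,\hat R,\hat S$. Let $T=(P-V_{1:k_0,:})^*P$ be nonsingular. Suppose that $\delta_1=\lVert V^*V-I_{k_0}\rVert_2\ll1$ and $\delta_2=\lVert P^*P-I_{k_0}\rVert_2\ll1$. Define \begin{align*} \delta_T&=\epsilon_T(k_0)+3\epsilon_{\mathrm{sv}}(k_0)(1+\epsilon_T(k_0)),\\ \delta&=\delta_1+\delta_2,\\ \epsilon_1&=\delta+2\delta_T+16\sqrt{k_0}\,\gamma_{k_0+1}+8k_0\gamma_{k_0+1}^2,\\ \eta&=2\sqrt{\lVert T^{-1}\rVert_2^2\epsilon_1+\lVert T^{-1}\rVert_2},\\ \epsilon_2&=(\delta_T+8k_0\gamma_{k_0+1}^2)\eta^2+4\sqrt{2k_0}\,\gamma_{k_0+1}\cdot\eta,\\ \epsilon_3&=2\sqrt{2k_0}\,\gamma_{n+2k_0+1}\cdot\eta+\bm{u}\bigl(\sqrt{1+\delta\eta^2}+\epsilon_2\bigr),\\ \epsilon_4&=\epsilon_2+\epsilon_3. \end{align*} If $\delta_T\lVert T^{-1}\rVert_2\le1/2$, then $\hat Q$ satisfies \begin{align*} \lVert\hat Q^*\hat Q-I\rVert_2&\le\epsilon_{\mathrm{orth}}(n-k_0,k)+2\bigl(\delta\eta^2+2\sqrt{k(1+\delta\eta^2)}\,\epsilon_4+k\epsilon_4^2\bigr),\\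 \lVert V^*\hat Q\rVert_F&\le\sqrt{2k}\,\bigl(2\sqrt{2k_0}\,\gamma_{k_0+1}+\epsilon_1\eta+\sqrt2\,\epsilon_3\bigr), \end{align*} and the residual $A-\hat Q\hat R-V\hat S$ satisfies $$\frac{\lVert A-\hat Q\hat R-V\hat S\rVert_2}{\lVert A\rVert_2}\le\delta\eta^2+\bigl(\sqrt{1+\delta\eta^2}+\sqrt k\,\epsilon_4\bigr)^2\bigl(\epsilon_{\mathrm{res}}(n-k_0,k)+\delta_2+3\sqrt k\,\epsilon_4+2k_0\gamma_{k_0}\bigr).$$
   Context: Notation: $M^*$ is the conjugate transpose, $M^{-*}=(M^{-1})^*$, $\lVert\cdot\rVert_2$ the spectral (or Euclidean) norm, $\lVert\cdot\rVert_F$ the Frobenius norm; $M_{i:j,k:l}$ is the submatrix with rows $i,\dots,j$ and columns $k,\dots,l$, and a bare colon means all indices. Absolute values and inequalities of matrices are componentwise. The notation $\ll1$ means sufficiently small compared with $1$ (in particular small enough that $\lVert V\rVert_2,\lVert P\rVert_2\le\sqrt2$ and similar crude norm bounds hold). Two-stage Householder-QR algorithm. Input: $V\in\mathbb{C}^{n\times k_0}$ with (nominally) orthonormal columns, $A\in\mathbb{C}^{n\times k}$, and a (nominally) unitary matrix $P\in\mathbb{C}^{k_0\times k_0}$. Steps: (1) $W\leftarrow\begin{bmatrix}P\\0\end{bmatrix}-V\in\mathbb{C}^{n\times k_0}$. (2) $T\leftarrow(P-V_{1:k_0,:})^*P$ (which equals $I_{k_0}-V_{1:k_0,:}^*P$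 for unitary $P$). (3) $A\leftarrow(I_n-WT^{-*}W^* )A$. (4) $S\leftarrow P^*A_{1:k_0,:}$ (with the updated $A$). (5) Compute a QR factorization $A_{k_0+1:n,:}=\underline{Q}R$ (with the updated $A$). (6) $Q\leftarrow(I_n-WT^{-1}W^* )\begin{bmatrix}0\\\underline{Q}\end{bmatrix}$. Output: $Q\in\mathbb{C}^{n\times k}$, $R\in\mathbb{C}^{k\times k}$, $S\in\mathbb{C}^{k_0\times k}$; in exact arithmetic $[V,A]=[V,Q]\begin{bmatrix}I_{k_0}&S\\0&R\end{bmatrix}$ with $[V,Q]^*[V,Q]=I_{k_0+k}$. Products with $I_n-WT^{-1}W^*$ and $I_n-WT^{-*}W^*$ are evaluated column by column without forming the $n\times n$ matrix: for a column $x$, first $W^*x$, then the solution of a linear system with $T$ (respectively $T^*$), then multiplication by $W$, then subtraction from $x$. Rounding model: $\mathrm{fl}(\cdot)$ denotes a computed value, and $\mathrm{fl}(a\circ b)=(a\circ b)(1+\theta)$ with $|\theta|\le\bm{u}$ for $\circ\in\{+,-,\times,/\}$, where $\bm{u}$ is the unit roundoff (the usual consequences are used, e.g. a computed product $My$ with $M$ having $m$ columns equals $(M+\Delta M)y$ with $|\Delta M|\le\gamma_m|M|$). $\gamma_m=(1-\bm{u})^{-m}-1$. The computed value of each variable of the algorithm is denoted by the variable with a hat; $V$, $A$, $P$ are the given data, while $W$ and $T$ without hats are the exact values $\begin{bmatrix}P\\0\end{bmatrix}-V$ and $(P-V_{1:k_0,:})^*P$. Assumptions: (i) For a QR factorization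 of an $m\times l$ matrix $M=QR$, the computed factors satisfy $\lVert\hat Q^*\hat Q-I_l\rVert_2\le\epsilon_{\mathrm{orth}}(m,l)$ and $\lVert M-\hat Q\hat R\rVert_2\le\epsilon_{\mathrm{res}}(m,l)\lVert M\rVert_2$, where $\epsilon_{\mathrm{orth}},\epsilon_{\mathrm{res}}\ll1$ are functions of $\bm{u},m,l$; as a result $\lVert\hat Q\rVert_2\le\sqrt2$ and $\lVert\hat R\rVert_2\le\sqrt2\,\lVert M\rVert_2$. (ii) The computed $\hat T$ satisfies $\lVert\hat T-T\rVert_2\le\epsilon_T(k_0)$, where $\epsilon_T(k_0)$ is a function of $\bm{u}$ and $k_0$. (iii) For $M\in\mathbb{C}^{m\times m}$ and $b\in\mathbb{C}^m$, the computed solution $\hat x$ of $Mx=b$ satisfies $(M+\Delta M)\hat x=b$ with $\lVert\Delta M\rVert_2\le\epsilon_{\mathrm{sv}}(m)\lVert M\rVert_2$, where $\epsilon_{\mathrm{sv}}(m)$ is a function of $\bm{u}$ and $m$. *)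

(* Defs.v *)
From mathcomp Require Export all_boot all_order all_algebra.
From mathcomp Require Export classical_sets reals complex.
Export Order.TTheory GRing.Theory Num.Theory.

Set Implicit Arguments.
Unset Strict Implicit.
Unset Printing Implicit Defensive.

Local Open Scope ring_scope.
Local Open Scope sesquilinear_scope.

(* [ComplexField.Normc.normc] is the modulus as an element of R, whereas
   [`|z|] would live in R[i]. *)
Definition cabs (R : realType) (z : R[i]) : R := ComplexField.Normc.normc z.

(* On column vectors this is the Euclidean norm. *)
Definition normF (R : realType) (m n : nat) (M : 'M[R[i]]_(m, n)) : R :=
  Num.sqrt (\sum_(i < m) \sum_(j < n) cabs (M i j) ^+ 2).

(* Operator norm induced by the Euclidean norms. The set is nonempty (x = 0)
   and bounded by normF M, so the supremum is genuine, also for empty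
   matrices, which have norm 0. *)
Definition norm2 (R : realType) (m n : nat) (M : 'M[R[i]]_(m, n)) : R :=
  sup [set normF (M *m x) | x in [set x : 'cV[R[i]]_n | normF x <= 1]]%classic.

Definition gamma (R : realType) (u : R) (j : nat) : R := (1 - u) ^- j - 1.

(* A computed value is any value allowed by the rounding model: rounding is a
   relation between the exact result of one operation and the computed one, so
   different executions of the same operation may incur different errors. *)
Definition fl (R : realType) (u : R) (exact computed : R[i]) : Prop :=
  exists2 theta : R[i], cabs theta <= u & computed = exact * (1 + theta).

(* Computed value of \sum_(i in I) p i, with the additions performed in an
   arbitrary order and parenthesization; both operands of each addition are
   nonempty sums, hence exactly #|I|.-1 rounded additions occur. *)
Inductive fl_sum (R : realType) (u : R) (n : nat) (p : 'I_n -> R[i]) :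
    {set 'I_n} -> R[i] -> Prop :=
| fl_sum0 : fl_sum u p finset.set0 0
| fl_sum1 (i : 'I_n) : fl_sum u p (finset.set1 i) (p i)
| fl_sumD (I J : {set 'I_n}) (a b c : R[i]) :
    I != finset.set0 -> J != finset.set0 -> [disjoint I & J] ->
    fl_sum u p I a -> fl_sum u p J b -> fl u (a + b) c ->
    fl_sum u p (finset.setU I J) c.

Definition fl_mulmx (R : realType) (u : R) (m n l : nat)
    (M : 'M[R[i]]_(m, n)) (N : 'M[R[i]]_(n, l)) (Ch : 'M[R[i]]_(m, l)) : Prop :=
  forall (i : 'I_m) (j : 'I_l), exists2 p : 'I_n -> R[i],
    forall k : 'I_n, fl u (M i k * N k j) (p k) &
    fl_sum u p (finset.setTfor ('I_n)) (Ch i j).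

Definition fl_submx (R : realType) (u : R) (m n : nat)
    (M N Ch : 'M[R[i]]_(m, n)) : Prop :=
  forall (i : 'I_m) (j : 'I_n), fl u (M i j - N i j) (Ch i j).

(* xh is a computed solution of M x = b; e bounds the relative backward error
   of the linear solver. *)
Definition fl_solve (R : realType) (e : R) (m : nat)
    (M : 'M[R[i]]_m) (b xh : 'cV[R[i]]_m) : Prop :=
  exists2 dM : 'M[R[i]]_m, norm2 dM <= e * norm2 M & (M + dM) *m xh = b.

(* Qh, Rh are computed QR factors of M. Only the error bounds that the analysis
   grants to the QR algorithm are recorded; the triangular shape of Rh is
   irrelevant to them and is not imposed. *)
Definition fl_qr (R : realType) (eorth eres : R) (m l : nat)
    (M : 'M[R[i]]_(m, l)) (Qh : 'M[R[i]]_(m, l)) (Rh : 'M[R[i]]_l) : Prop :=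
  norm2 (Qh ^t* *m Qh - 1%:M) <= eorth /\
  norm2 (M - Qh *m Rh) <= eres * norm2 M.

(* Computed value of (I - W T^-1 W^* ) x for one column x: y is W^* x, z solves
   T z = y, w is W z. *)
Definition fl_apply (R : realType) (u esv : R) (n k0 : nat)
    (W : 'M[R[i]]_(n, k0)) (T : 'M[R[i]]_k0) (x xh : 'cV[R[i]]_n) : Prop :=
  exists y z : 'cV[R[i]]_k0, exists w : 'cV[R[i]]_n,
    [/\ fl_mulmx u (W ^t*) x y, fl_solve esv T y z,
        fl_mulmx u W z w & fl_submx u x w xh].

Definition fl_apply_cols (R : realType) (u esv : R) (n k0 l : nat)
    (W : 'M[R[i]]_(n, k0)) (T : 'M[R[i]]_k0) (X Xh : 'M[R[i]]_(n, l)) : Prop :=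
  forall j : 'I_l, fl_apply u esv W T (col j X) (col j Xh).

(* The number of rows n is written k0 + m, so that V_{1:k0,:} is [usubmx V]
   and V_{k0+1:n,:} is [dsubmx V]. *)
Definition exactT (R : realType) (k0 m : nat)
    (V : 'M[R[i]]_(k0 + m, k0)) (P : 'M[R[i]]_k0) : 'M[R[i]]_k0 :=
  (P - usubmx V) ^t* *m P.

(* Qh, Rh, Sh are outputs of one floating-point execution of the two-stage
   algorithm on V, A, P. Wh, Th, Ah are the computed W, T and updated A, and Qb
   is the computed orthonormal factor of the second stage. *)
Definition fl_two_stage (R : realType) (u eorth eres eT esv : R) (k0 m k : nat)
    (V : 'M[R[i]]_(k0 + m, k0)) (A : 'M[R[i]]_(k0 + m, k)) (P : 'M[R[i]]_k0)
    (Qh : 'M[R[i]]_(k0 + m, k)) (Rh : 'M[R[i]]_k) (Sh : 'M[R[i]]_(k0, k)) :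
    Prop :=
  exists (Wh : 'M[R[i]]_(k0 + m, k0)) (Th : 'M[R[i]]_k0)
         (Ah : 'M[R[i]]_(k0 + m, k)) (Qb : 'M[R[i]]_(m, k)),
    fl_submx u (col_mx P 0) V Wh /\
    norm2 (Th - exactT V P) <= eT /\
    fl_apply_cols u esv Wh (Th ^t*) A Ah /\
    fl_mulmx u (P ^t*) (usubmx Ah) Sh /\
    fl_qr eorth eres (dsubmx Ah) Qb Rh /\
    fl_apply_cols u esv Wh Th (col_mx 0 Qb) Qh.

(* Main.v *)
Require Import Defs.
From mathcomp Require Import all_boot all_order all_algebra.
From mathcomp Require Import boolp classical_sets reals complex ring lra zify.

Set Implicit Arguments.
Unset Strict Implicit.
Unset Printing Implicit Defensive.

Local Open Scope ring_scope.
Local Open Scope sesquilinear_scope.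

(** Let [W = [P; 0] - V], let [T] be as in the algorithm, and write [H] for
    [I - W T^-1 W^*].  Everything rests on the identity
    [W^* W = T + T^* + E] with [E = (V^* V - I) - (P^* P - I)]
    (gram_exactW), so that [‖E‖ <= delta].

    The identity shows that [H^* H - I = W T^-* E T^-1 W^*], whose norm is at
    most [delta * eta ^ 2], because [T^-1 W^* W T^-*] equals
    [T^-* + T^-1 + T^-1 E T^-*] (norm2_inv_mul_adj, house_near_unitary).  The
    same computation applies to [W + D] and [U] close to [W] and [T]: the
    condition [deltaT * ‖T^-1‖ <= 1/2] gives [‖U^-1‖ <= 2 ‖T^-1‖], and [eta] is
    chosen to bound [U^-1 W^*] with all perturbations included.  Hence
    [I - (W + D) U^-1 (W + D)^*] differs from [H] by at most [eps2]
    (house_perturbed).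

    Applying [H] in floating-point arithmetic to a column [x] yields
    [(I - (W + D) U^-1 (W + D)^* ) x + r] with [‖r‖ <= eps3 ‖x‖]
    (fl_apply_house): the backward error of the product with [W] serves as
    [D]; that of the product with [W^*] is different, and the difference is
    moved into [r].  So the computed column is within [eps4 ‖x‖] of [H x]
    (fl_apply_forward).  Since [T^*] satisfies the same hypotheses as [T] and
    [H^* = I - W T^-* W^*], this covers both applications in the algorithm.

    The three bounds follow.
    - Orthogonality: expand [Q^* Q] for [Q = H X + D] with [X = [0; Qb]]
      (orthogonality_bound).
    - Orthogonality to [V]: for [x = [0; q]] one has [V^* x = - W^* x], and
      [V^*] times the perturbed reflector times [x] equals
      [D^* x - (U + V^* (W + D)) U^-1 (W + D)^* x], where
      [T + V^* W = (P^* P - I) - (V^* V - I)] is small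
      (cross_orthogonality_bound).
    - Residual: [H] maps [[M; 0]] to [V P^-1 M] (house_col_mx0), so that
      [A - Q R - V S] splits into six small terms (residual_algebra), estimated
      one by one (residual_bound).  The term with [P^-1 - P^*] carries a factor
      [‖V‖ ‖P^-1‖] that may exceed 1; it is at most
      [sqrt (1 + delta * eta ^ 2)] because [‖T^-1‖ >= 1/3] unless [P^* P = I]
      (norm2_V_invP).

    The crude norm bounds hold as soon as [delta1], [delta2] and the two error
    constants of the QR factorization are at most 1/8. *)

(** * Modulus and Frobenius norm *)

Section Modulus.
Variable R : realType.
Implicit Types z w : R[i].

Lemma cabsE z : (cabs z)%:C%C = `|z|.
Proof. by []. Qed.

Lemma cabs_ge0 z : 0 <= cabs z.
Proof. by rewrite -lecR cabsE normr_ge0. Qed.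

Lemma cabs0 : cabs (0 : R[i]) = 0.
Proof. exact: ComplexField.Normc.normc0. Qed.

Lemma cabs1 : cabs (1 : R[i]) = 1.
Proof. exact: ComplexField.Normc.normc1. Qed.

Lemma cabsM z w : cabs (z * w) = cabs z * cabs w.
Proof. exact: ComplexField.Normc.normcM. Qed.

Lemma cabsD z w : cabs (z + w) <= cabs z + cabs w.
Proof. exact: le_normcD. Qed.

Lemma cabsN z : cabs (- z) = cabs z.
Proof. exact: normcN. Qed.


Lemma cabs_conj z : cabs z^* = cabs z.
Proof. by apply: (@complexI R); rewrite !cabsE norm_conjC. Qed.

Lemma cabs_real (x : R) : 0 <= x -> cabs x%:C%C = x.
Proof.
by move=> x0; apply: (@complexI R); rewrite cabsE ger0_norm // lecR.
Qed.

Lemma mul_conj_cabs z : z^* * z = (cabs z ^+ 2)%:C%C.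
Proof. by rewrite mulrC -normCK rmorphXn /= cabsE. Qed.

Lemma cabs_sum (I : Type) (r : seq I) (P : pred I) (F : I -> R[i]) :
  cabs (\sum_(i <- r | P i) F i) <= \sum_(i <- r | P i) cabs (F i).
Proof.
elim/big_rec2: _ => [|i x y _ h]; first by rewrite cabs0.
by rewrite (le_trans (cabsD _ _)) // lerD2l.
Qed.

End Modulus.

Section FrobeniusNorm.
Variable R : realType.

Lemma Cauchy_Schwarz_sum (I : finType) (a b : I -> R) :
  (\sum_i a i * b i) ^+ 2 <= (\sum_i a i ^+ 2) * (\sum_i b i ^+ 2).
Proof.
set X := \sum_i a i ^+ 2; set Y := \sum_i b i ^+ 2; set Z := \sum_i _ * _.
have X0 : 0 <= X by apply: sumr_ge0 => i _; rewrite sqr_ge0.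
have quad t : 0 <= X * t ^+ 2 - 2 * Z * t + Y.
  have -> : X * t ^+ 2 - 2 * Z * t + Y = \sum_i (a i * t - b i) ^+ 2.
    rewrite /X /Y /Z !mulr_suml mulr_sumr mulr_suml -sumrB -big_split /=.
    by apply: eq_bigr => i _; ring.
  by apply: sumr_ge0 => i _; rewrite sqr_ge0.
have [X_eq0|X_neq0] := eqVneq X 0.
  have Z0 : Z = 0.
    apply: big1 => i _.
    have : a i ^+ 2 == 0.
      by move/eqP: X_eq0; rewrite psumr_eq0
        => [/allP/(_ i (mem_index_enum i))|j _]; rewrite ?sqr_ge0.
    by rewrite sqrf_eq0 => /eqP ->; rewrite mul0r.
  by rewrite Z0 X_eq0 mul0r expr0n.
have Xgt : 0 < X by rewrite lt_def X_neq0.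
have := mulr_ge0 X0 (quad (Z / X)).
have -> : X * (X * (Z / X) ^+ 2 - 2 * Z * (Z / X) + Y) = X * Y - Z ^+ 2.
  by field.
by rewrite subr_ge0.
Qed.

Lemma normF_sqr m n (M : 'M[R[i]]_(m, n)) :
  normF M ^+ 2 = \sum_i \sum_j cabs (M i j) ^+ 2.
Proof.
rewrite sqr_sqrtr //.
by apply: sumr_ge0 => i _; apply: sumr_ge0 => j _; rewrite sqr_ge0.
Qed.

Section Dims.
Variables m n : nat.
Implicit Types M N : 'M[R[i]]_(m, n).

Lemma normF_ge0 M : 0 <= normF M.
Proof. exact: sqrtr_ge0. Qed.

Lemma normF0 : normF (0 : 'M[R[i]]_(m, n)) = 0.
Proof.
apply/eqP; rewrite -sqrf_eq0 normF_sqr; apply/eqP.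
by apply: big1 => i _; apply: big1 => j _; rewrite mxE cabs0 expr0n.
Qed.

Lemma normF_eq0 M : normF M = 0 -> M = 0.
Proof.
move=> M0; have := normF_sqr M; rewrite M0 expr0n /= => /esym/eqP.
rewrite psumr_eq0 => [/allP h|i _]; last first.
  by apply: sumr_ge0 => j _; rewrite sqr_ge0.
apply/matrixP => i j; rewrite mxE.
have := h i (mem_index_enum i); rewrite /= psumr_eq0 => [/allP|k _]; last first.
  by rewrite sqr_ge0.
move/(_ j (mem_index_enum j)); rewrite /= sqrf_eq0 => /eqP.
exact: ComplexField.Normc.eq0_normc.
Qed.

(** The square of the Frobenius norm is additive over columns. *)
Lemma normF_sqr_col M : normF M ^+ 2 = \sum_j normF (col j M) ^+ 2.
Proof.
rewrite normF_sqr exchange_big /=; apply: eq_bigr => j _.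
by rewrite normF_sqr; apply: eq_bigr => i _; rewrite big_ord1 mxE.
Qed.

Lemma normF_le_sqr M (a : R) : 0 <= a -> normF M ^+ 2 <= a ^+ 2 -> normF M <= a.
Proof. by move=> a0; rewrite ler_pXn2r // nnegrE // normF_ge0. Qed.

Lemma normFD M N : normF (M + N) <= normF M + normF N.
Proof.
apply: normF_le_sqr; first by rewrite addr_ge0 ?normF_ge0.
pose f (p : 'I_m * 'I_n) := cabs (M p.1 p.2).
pose g (p : 'I_m * 'I_n) := cabs (N p.1 p.2).
have EM : normF M ^+ 2 = \sum_p f p ^+ 2 by rewrite normF_sqr pair_bigA.
have EN : normF N ^+ 2 = \sum_p g p ^+ 2 by rewrite normF_sqr pair_bigA.
have CS : \sum_p f p * g p <= normF M * normF N.
  rewrite -(@ler_pXn2r _ 2) // ?nnegrE ?mulr_ge0 ?normF_ge0 //; last first.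
    by apply: sumr_ge0 => p _; rewrite mulr_ge0 ?cabs_ge0.
  by rewrite exprMn EM EN Cauchy_Schwarz_sum.
have -> : (normF M + normF N) ^+ 2 =
    normF M ^+ 2 + normF N ^+ 2 + 2 * (normF M * normF N) by ring.
apply: le_trans (_ : \sum_p (f p ^+ 2 + g p ^+ 2 + 2 * (f p * g p)) <= _).
  rewrite normF_sqr pair_bigA; apply: ler_sum => -[i j] _ /=.
  rewrite mxE; have -> : f (i, j) ^+ 2 + g (i, j) ^+ 2 + 2 * (f (i, j) * g (i, j)) =
    (f (i, j) + g (i, j)) ^+ 2 by ring.
  by rewrite ler_pXn2r ?nnegrE ?cabs_ge0 ?addr_ge0 ?cabs_ge0 // cabsD.
by rewrite !big_split /= -EM -EN -mulr_sumr lerD2l ler_pM2l.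
Qed.

Lemma normF_entrywise M N (g : R) : 0 <= g ->
  (forall i j, cabs (M i j) <= g * cabs (N i j)) -> normF M <= g * normF N.
Proof.
move=> g0 h; apply: normF_le_sqr; first by rewrite mulr_ge0 ?normF_ge0.
rewrite exprMn !normF_sqr mulr_sumr; apply: ler_sum => i _.
rewrite mulr_sumr; apply: ler_sum => j _; rewrite -exprMn.
by rewrite ler_pXn2r ?nnegrE ?cabs_ge0 ?mulr_ge0 ?cabs_ge0.
Qed.

Lemma normFN M : normF (- M) = normF M.
Proof.
rewrite /normF; congr Num.sqrt; apply: eq_bigr => i _; apply: eq_bigr => j _.
by rewrite mxE cabsN.
Qed.

Lemma normFB M N : normF (M - N) <= normF M + normF N.
Proof. by rewrite (le_trans (normFD _ _)) // normFN. Qed.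

Lemma normFZ (a : R) M : 0 <= a -> normF (a%:C%C *: M) = a * normF M.
Proof.
move=> a0; apply/eqP; rewrite -(@eqrXn2 _ 2) ?mulr_ge0 ?normF_ge0 //.
rewrite exprMn !normF_sqr mulr_sumr; apply/eqP; apply: eq_bigr => i _.
rewrite mulr_sumr; apply: eq_bigr => j _.
by rewrite mxE cabsM cabs_real // exprMn.
Qed.

End Dims.

Lemma normF_adj m n (M : 'M[R[i]]_(m, n)) : normF (M ^t*) = normF M.
Proof.
rewrite /normF exchange_big /=; congr Num.sqrt.
by apply: eq_bigr => i _; apply: eq_bigr => j _; rewrite !mxE cabs_conj.
Qed.

(** With [g = 1] this gives submultiplicativity; with [g = gamma u n] it bounds
    the rounding errors of a matrix product. *)
Lemma normF_entrywise_mul m n l (E : 'M[R[i]]_(m, l)) (M : 'M[R[i]]_(m, n))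
    (N : 'M[R[i]]_(n, l)) (g : R) : 0 <= g ->
  (forall i j, cabs (E i j) <= g * \sum_k cabs (M i k) * cabs (N k j)) ->
  normF E <= g * (normF M * normF N).
Proof.
move=> g0 h; apply: normF_le_sqr; first by rewrite !mulr_ge0 ?normF_ge0.
rewrite !exprMn (normF_sqr M) (normF_sqr_col N) (normF_sqr E).
rewrite mulr_suml mulr_sumr; apply: ler_sum => i _.
rewrite mulr_sumr mulr_sumr; apply: ler_sum => j _.
have s0 : 0 <= \sum_k cabs (M i k) * cabs (N k j).
  by apply: sumr_ge0 => k _; rewrite mulr_ge0 ?cabs_ge0.
apply: le_trans (_ : (g * \sum_k cabs (M i k) * cabs (N k j)) ^+ 2 <= _).
  by rewrite ler_pXn2r ?nnegrE ?cabs_ge0 ?mulr_ge0.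
rewrite exprMn ler_wpM2l ?sqr_ge0 // normF_sqr.
apply: le_trans (Cauchy_Schwarz_sum _ _) _.
rewrite ler_wpM2l //; first by apply: sumr_ge0 => k _; rewrite sqr_ge0.
by apply: ler_sum => k _; rewrite big_ord1 mxE.
Qed.

Lemma normFM m n l (M : 'M[R[i]]_(m, n)) (N : 'M[R[i]]_(n, l)) :
  normF (M *m N) <= normF M * normF N.
Proof.
rewrite -[leRHS]mul1r; apply: normF_entrywise_mul => // i j.
rewrite mul1r mxE (le_trans (cabs_sum _ _ _)) //.
by apply: ler_sum => k _; rewrite cabsM.
Qed.

(** For a column [x], [x^* x] is the square of the Euclidean norm. *)
Lemma normF_gram n (x : 'cV[R[i]]_n) : normF (x ^t* *m x) = normF x ^+ 2.
Proof.
have E : (x ^t* *m x) 0 0 = (normF x ^+ 2)%:C%C.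
  rewrite normF_sqr mxE rmorph_sum; apply: eq_bigr => i _ /=.
  by rewrite !mxE big_ord1 mul_conj_cabs.
rewrite /normF big_ord1 big_ord1 sqrtr_sqr ger0_norm ?cabs_ge0 //.
rewrite E cabs_real ?sqr_ge0 // sqr_sqrtr //.
Qed.

Lemma normF_col_mx m1 m2 n (M : 'M[R[i]]_(m1, n)) (N : 'M[R[i]]_(m2, n)) :
  normF (col_mx M N) ^+ 2 = normF M ^+ 2 + normF N ^+ 2.
Proof.
rewrite !normF_sqr big_split_ord /=; congr (_ + _).
  by apply: eq_bigr => i _; apply: eq_bigr => j _; rewrite col_mxEu.
by apply: eq_bigr => i _; apply: eq_bigr => j _; rewrite col_mxEd.
Qed.

End FrobeniusNorm.

(** * Operator norm *)

Section Adjoint.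
Variable R : realType.

Lemma ctmxM m n l (M : 'M[R[i]]_(m, n)) (N : 'M[R[i]]_(n, l)) :
  (M *m N) ^t* = N ^t* *m M ^t*.
Proof. by rewrite trmx_mul map_mxM. Qed.

Lemma ctmxK m n (M : 'M[R[i]]_(m, n)) : (M ^t*) ^t* = M.
Proof. by apply/matrixP => i j; rewrite !mxE conjCK. Qed.

Lemma ctmxD m n (M N : 'M[R[i]]_(m, n)) : (M + N) ^t* = M ^t* + N ^t*.
Proof. by rewrite linearD /= map_mxD. Qed.

Lemma ctmxN m n (M : 'M[R[i]]_(m, n)) : (- M) ^t* = - M ^t*.
Proof. by rewrite linearN /= map_mxN. Qed.

Lemma ctmx1 n : (1%:M : 'M[R[i]]_n) ^t* = 1%:M.
Proof. by rewrite trmx1 map_mx1. Qed.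

Lemma ctmx_inv n (M : 'M[R[i]]_n) : (invmx M) ^t* = invmx (M ^t*).
Proof. by rewrite trmx_inv map_invmx. Qed.

Lemma ctmx_unit n (M : 'M[R[i]]_n) : (M ^t* \in unitmx) = (M \in unitmx).
Proof. by rewrite map_unitmx unitmx_tr. Qed.

End Adjoint.

Section OperatorNorm.
Variable R : realType.

Section Dims.
Variables m n : nat.
Implicit Types M N : 'M[R[i]]_(m, n).

Lemma norm2_has_sup M :
  has_sup [set normF (M *m x) | x in [set x : 'cV[R[i]]_n | normF x <= 1]]%classic.
Proof.
split.
  by exists (normF (M *m (0 : 'cV[R[i]]_n))); exists 0 => //=; rewrite normF0.
exists (normF M) => _ [x /= x1 <-].
by rewrite (le_trans (normFM _ _)) // ler_piMr ?normF_ge0.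
Qed.

Lemma norm2_ge0 M : 0 <= norm2 M.
Proof.
have [_ ub] := norm2_has_sup M.
rewrite -[leLHS](normF0 R m 1) -(mulmx0 _ M); apply: (@ub_le_sup R) => //.
by exists 0 => //=; rewrite normF0.
Qed.

Lemma normF_mulv M (x : 'cV[R[i]]_n) : normF (M *m x) <= norm2 M * normF x.
Proof.
have [/normF_eq0 ->|x0] := eqVneq (normF x) 0.
  by rewrite mulmx0 !normF0 mulr0.
have xgt : 0 < normF x by rewrite lt_def x0 normF_ge0.
have [_ ub] := norm2_has_sup M.
rewrite -ler_pdivrMr // mulrC -normFZ ?invr_ge0 ?normF_ge0 // scalemxAr.
apply: (@ub_le_sup R) => //; exists ((normF x)^-1%:C%C *: x) => //=.
by rewrite normFZ ?invr_ge0 ?normF_ge0 // mulVf.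
Qed.

Lemma norm2_le M (a : R) : 0 <= a ->
  (forall x : 'cV[R[i]]_n, normF (M *m x) <= a * normF x) -> norm2 M <= a.
Proof.
move=> a0 h; apply: ge_sup; first by have [] := norm2_has_sup M.
by move=> _ [x /= x1 <-]; rewrite (le_trans (h x)) // ler_piMr.
Qed.

Lemma norm2_le_normF M : norm2 M <= normF M.
Proof. by apply: norm2_le => [|x]; rewrite ?normF_ge0 ?normFM. Qed.


Lemma norm2N M : norm2 (- M) = norm2 M.
Proof.
have h N : norm2 (- N) <= norm2 N.
  by apply: norm2_le => [|x]; rewrite ?norm2_ge0 // mulNmx normFN normF_mulv.
apply: le_anti; apply/andP; split; first exact: h.
by have := h (- M); rewrite opprK.
Qed.

Lemma norm2D M N (a b : R) :
  norm2 M <= a -> norm2 N <= b -> norm2 (M + N) <= a + b.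
Proof.
move=> hM hN; apply: le_trans (lerD hM hN).
apply: norm2_le => [|x]; first by rewrite addr_ge0 ?norm2_ge0.
by rewrite mulmxDl (le_trans (normFD _ _)) // mulrDl lerD ?normF_mulv.
Qed.

Lemma norm2B M N (a b : R) :
  norm2 M <= a -> norm2 N <= b -> norm2 (M - N) <= a + b.
Proof. by move=> hM hN; apply: (norm2D hM); rewrite norm2N. Qed.

End Dims.

(* From here on, norms and matrix operations are used only through their
   algebraic properties. *)
Opaque norm2 normF cabs mulmx map_mx trmx scalar_mx invmx addmx oppmx.

Lemma norm2M m n l (M : 'M[R[i]]_(m, n)) (N : 'M[R[i]]_(n, l)) (a b : R) :
  norm2 M <= a -> norm2 N <= b -> norm2 (M *m N) <= a * b.
Proof.
move=> hM hN; apply: norm2_le => [|x].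
  by rewrite mulr_ge0 ?(le_trans (norm2_ge0 _) hM) ?(le_trans (norm2_ge0 _) hN).
rewrite -mulmxA -mulrA (le_trans (normF_mulv _ _)) //.
rewrite ler_pM ?norm2_ge0 ?normF_ge0 //.
by rewrite (le_trans (normF_mulv _ _)) // ler_wpM2r ?normF_ge0.
Qed.

Lemma normF_mulv_le m n (M : 'M[R[i]]_(m, n)) (x : 'cV[R[i]]_n) (a b : R) :
  norm2 M <= a -> normF x <= b -> normF (M *m x) <= a * b.
Proof.
move=> hM hx; rewrite (le_trans (normF_mulv _ _)) //.
by rewrite ler_pM ?norm2_ge0 ?normF_ge0.
Qed.


Lemma norm2_1 n : norm2 (1%:M : 'M[R[i]]_n) <= 1.
Proof. by apply: norm2_le => // x; rewrite mul1mx mul1r. Qed.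

(** [‖M^* y‖^2 = y^* (M M^* y)], whence the bound by Cauchy-Schwarz. *)
Lemma norm2_adj_le m n (M : 'M[R[i]]_(m, n)) : norm2 (M ^t*) <= norm2 M.
Proof.
apply: norm2_le => [|y]; first exact: norm2_ge0.
have [->|y0] := eqVneq (normF (M ^t* *m y)) 0.
  by rewrite mulr_ge0 ?norm2_ge0 ?normF_ge0.
have ygt : 0 < normF (M ^t* *m y) by rewrite lt_def y0 normF_ge0.
rewrite -(ler_pM2r ygt) -expr2 -normF_gram ctmxM ctmxK -mulmxA.
apply: le_trans (normFM _ _) _; rewrite normF_adj mulrC.
by rewrite (mulrAC (norm2 M)) ler_wpM2r ?normF_ge0 // normF_mulv.
Qed.

Lemma norm2_adj m n (M : 'M[R[i]]_(m, n)) : norm2 (M ^t*) = norm2 M.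
Proof. by apply: le_anti; rewrite norm2_adj_le -{1}(ctmxK M) norm2_adj_le. Qed.

Lemma normF_sqr_mulv m n (M : 'M[R[i]]_(m, n)) (x : 'cV[R[i]]_n) (a : R) :
  norm2 (M ^t* *m M) <= a -> normF (M *m x) ^+ 2 <= a * normF x ^+ 2.
Proof.
move=> h; rewrite -normF_gram ctmxM -mulmxA (le_trans (normFM _ _)) //.
rewrite normF_adj expr2 mulrCA ler_wpM2l ?normF_ge0 //.
by rewrite mulmxA normF_mulv_le.
Qed.

Lemma norm2_gram m n (M : 'M[R[i]]_(m, n)) (a : R) : 0 <= a ->
  norm2 (M ^t* *m M) <= a ^+ 2 -> norm2 M <= a.
Proof.
move=> a0 h; apply: norm2_le => // x; apply: normF_le_sqr.
  by rewrite mulr_ge0 ?normF_ge0.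
by rewrite exprMn normF_sqr_mulv.
Qed.

Lemma norm2_gram_adj m n (M : 'M[R[i]]_(m, n)) (a : R) : 0 <= a ->
  norm2 (M *m M ^t*) <= a ^+ 2 -> norm2 M <= a.
Proof.
by move=> a0 h; rewrite -norm2_adj; apply: (norm2_gram a0); rewrite ctmxK.
Qed.

(** [M^* M] close to the identity means that [M] nearly preserves the norm. *)
Lemma normF_near_iso m n (M : 'M[R[i]]_(m, n)) (x : 'cV[R[i]]_n) (d : R) :
  norm2 (M ^t* *m M - 1%:M) <= d ->
  (1 - d) * normF x ^+ 2 <= normF (M *m x) ^+ 2 <= (1 + d) * normF x ^+ 2.
Proof.
move=> h; apply/andP; split; last first.
  apply: normF_sqr_mulv; rewrite -(subrK 1%:M (M ^t* *m M)) addrC.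
  exact: norm2D (norm2_1 _) h.
have E : x ^t* *m x = (M *m x) ^t* *m (M *m x) - x ^t* *m ((M ^t* *m M - 1%:M) *m x).
  by rewrite ctmxM mulmxBl mulmxBr mul1mx !mulmxA opprB addrC subrK.
rewrite mulrBl mul1r lerBlDr -{1}(normF_gram x) E (le_trans (normFB _ _)) //.
rewrite normF_gram lerD2l; apply: le_trans (normFM _ _) _.
rewrite normF_adj expr2 mulrCA; apply: ler_wpM2l; first exact: normF_ge0.
exact: normF_mulv_le.
Qed.

Lemma norm2_near_iso m n (M : 'M[R[i]]_(m, n)) (d a : R) :
  norm2 (M ^t* *m M - 1%:M) <= d -> 0 <= a -> 1 + d <= a ^+ 2 -> norm2 M <= a.
Proof.
move=> h a0 ha; apply: norm2_gram => //.
apply: le_trans ha; rewrite -(subrK 1%:M (M ^t* *m M)) addrC.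
exact: norm2D (norm2_1 _) h.
Qed.

Lemma normF_le_cols m n (M : 'M[R[i]]_(m, n)) :
  normF M <= Num.sqrt n%:R * norm2 M.
Proof.
apply: normF_le_sqr; first by rewrite mulr_ge0 ?sqrtr_ge0 ?norm2_ge0.
rewrite exprMn (@sqr_sqrtr R n%:R) ?ler0n // normF_sqr_col.
apply: le_trans (_ : \sum_(j < n) norm2 M ^+ 2 <= _); last first.
  by rewrite sumr_const card_ord mulr_natl.
apply: ler_sum => j _; rewrite ler_pXn2r ?nnegrE ?normF_ge0 ?norm2_ge0 //.
rewrite colE (le_trans (normF_mulv _ _)) // ler_piMr ?norm2_ge0 //.
apply: normF_le_sqr => //; rewrite normF_sqr (bigD1 j) //= big_ord1 !mxE !eqxx.
rewrite cabs1 big1 ?addr0 // => i ij.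
by rewrite big_ord1 mxE (negbTE ij) cabs0 expr0n.
Qed.

Lemma normF_le_rows m n (M : 'M[R[i]]_(m, n)) :
  normF M <= Num.sqrt m%:R * norm2 M.
Proof. by rewrite -normF_adj -norm2_adj normF_le_cols. Qed.

Lemma norm2_col_mx0 m1 m2 n (M : 'M[R[i]]_(m1, n)) :
  norm2 (col_mx M (0 : 'M_(m2, n))) <= norm2 M.
Proof.
apply: norm2_le => [|x]; first exact: norm2_ge0.
rewrite mul_col_mx mul0mx; apply: normF_le_sqr.
  by rewrite mulr_ge0 ?norm2_ge0 ?normF_ge0.
rewrite normF_col_mx normF0 expr0n addr0.
by rewrite ler_pXn2r ?nnegrE ?normF_ge0 ?mulr_ge0 ?norm2_ge0 ?normF_ge0 ?normF_mulv.
Qed.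

Lemma norm2_col_0mx m1 m2 n (M : 'M[R[i]]_(m2, n)) :
  norm2 (col_mx (0 : 'M_(m1, n)) M) <= norm2 M.
Proof.
apply: norm2_le => [|x]; first exact: norm2_ge0.
rewrite mul_col_mx mul0mx; apply: normF_le_sqr.
  by rewrite mulr_ge0 ?norm2_ge0 ?normF_ge0.
rewrite normF_col_mx normF0 expr0n add0r.
by rewrite ler_pXn2r ?nnegrE ?normF_ge0 ?mulr_ge0 ?norm2_ge0 ?normF_ge0 ?normF_mulv.
Qed.

Lemma normF_col_0mx m1 m2 n (M : 'M[R[i]]_(m2, n)) :
  normF (col_mx (0 : 'M_(m1, n)) M) = normF M.
Proof.
apply/eqP; rewrite -(@eqrXn2 _ 2) ?normF_ge0 //.
by rewrite normF_col_mx normF0 expr0n add0r.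
Qed.

Lemma norm2_usubmx m1 m2 n (M : 'M[R[i]]_(m1 + m2, n)) :
  norm2 (usubmx M) <= norm2 M.
Proof.
apply: norm2_le => [|x]; first exact: norm2_ge0.
rewrite (le_trans _ (normF_mulv M x)) //; apply: normF_le_sqr.
  exact: normF_ge0.
by rewrite -{2}(vsubmxK M) mul_col_mx normF_col_mx lerDl sqr_ge0.
Qed.

Lemma norm2_dsubmx m1 m2 n (M : 'M[R[i]]_(m1 + m2, n)) :
  norm2 (dsubmx M) <= norm2 M.
Proof.
apply: norm2_le => [|x]; first exact: norm2_ge0.
rewrite (le_trans _ (normF_mulv M x)) //; apply: normF_le_sqr.
  exact: normF_ge0.
by rewrite -{2}(vsubmxK M) mul_col_mx normF_col_mx lerDr sqr_ge0.
Qed.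

(** A perturbation with [‖U - T‖ ‖T^-1‖ <= 1/2] keeps [T] invertible and at most
    doubles the norm of the inverse. *)
Lemma perturbed_inverse n (T U : 'M[R[i]]_n) :
  T \in unitmx -> norm2 (U - T) * norm2 (invmx T) <= 1 / 2 ->
  U \in unitmx /\ norm2 (invmx U) <= 2 * norm2 (invmx T).
Proof.
move=> uT h.
have key (x : 'cV[R[i]]_n) : normF x <= 2 * norm2 (invmx T) * normF (U *m x).
  have E : x = invmx T *m (U *m x - (U - T) *m x).
    by rewrite mulmxBl opprB addrC subrK mulKmx.
  have h1 : normF x <= norm2 (invmx T) * (normF (U *m x) + norm2 (U - T) * normF x).
    rewrite {1}E normF_mulv_le // (le_trans (normFB _ _)) //.
    by rewrite lerD2l normF_mulv.
  move: h1 (ler_wpM2r (normF_ge0 x) h).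
  move: (normF x) (normF (U *m x)) (norm2 (U - T)) (norm2 (invmx T)) => a b d t.
  by move=> h1 h2; lra.
have uU : U \in unitmx.
  rewrite -unitmx_tr -row_free_unit -kermx_eq0; apply/eqP/row_matrixP => i.
  rewrite row0; set v := row i _.
  have /(congr1 trmx) : v *m U^T = 0 by rewrite -row_mul mulmx_ker row0.
  rewrite trmx_mul trmxK trmx0 => Uv.
  have : normF v^T <= 0 by rewrite (le_trans (key _)) // Uv normF0 mulr0.
  move=> v0; have /normF_eq0 vT0 : normF v^T = 0.
    by apply: le_anti; rewrite v0 normF_ge0.
  by rewrite -(trmxK v) vT0 trmx0.
split=> //; apply: norm2_le => [|x]; first by rewrite mulr_ge0 ?norm2_ge0.
by rewrite (le_trans (key _)) // mulKVmx.
Qed.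

End OperatorNorm.

(** * Rounding errors *)

Section Rounding.
Variables (R : realType) (u : R).
Hypothesis u01 : 0 <= u < 1.

Let u_lt1 : 0 < 1 - u.
Proof. by rewrite subr_gt0; case/andP: u01. Qed.

Lemma gammaD a b : 1 + gamma u (a + b) = (1 + gamma u a) * (1 + gamma u b).
Proof. by rewrite /gamma ![1 + _]addrC !subrK exprD invfM. Qed.

Lemma gamma0 : gamma u 0 = 0.
Proof. by rewrite /gamma expr0 invr1 subrr. Qed.

Lemma le_u_gamma1 : u <= gamma u 1.
Proof.
rewrite /gamma expr1 lerBrDr -(ler_pM2r u_lt1) mulVf ?gt_eqF //.
have -> : (u + 1) * (1 - u) = 1 - u ^+ 2 by ring.
by rewrite lerBlDr lerDl sqr_ge0.
Qed.

Lemma gamma_ge0 j : 0 <= gamma u j.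
Proof.
have u0 : 0 <= u by case/andP: u01.
have g1 : 0 <= gamma u 1 := le_trans u0 le_u_gamma1.
elim: j => [|j IH]; first by rewrite gamma0.
rewrite -(lerD2l 1) addr0 -addn1 gammaD mulr_ege1 // lerDl //.
Qed.

Lemma gamma_sum a b : gamma u a + gamma u b + gamma u a * gamma u b = gamma u (a + b).
Proof. by apply: (addrI 1); rewrite gammaD; ring. Qed.

Lemma gamma_mono a b : (a <= b)%N -> gamma u a <= gamma u b.
Proof.
move=> /subnKC <-; rewrite -gamma_sum -addrA lerDl.
by rewrite addr_ge0 ?mulr_ge0 ?gamma_ge0.
Qed.

Lemma le_muln_gamma j : j%:R * u <= gamma u j.
Proof.
elim: j => [|j IH]; first by rewrite mul0r gamma0.
rewrite -addn1 natrD mulrDl mul1r -gamma_sum -[leLHS]addr0.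
by rewrite !lerD ?le_u_gamma1 ?mulr_ge0 ?gamma_ge0.
Qed.

(** The rounding of the last subtraction is absorbed in the indices of
    [gamma]: since both indices are at least 2, the product of the two
    constants exceeds [u] times their sum. *)
Lemma gamma_round_sum a b : (1 < a)%N -> (1 < b)%N ->
  (1 + u) * (gamma u a + gamma u b) <= gamma u (a + b).
Proof.
move=> a1 b1; rewrite -gamma_sum mulrDl mul1r lerD2l.
have u0 : 0 <= u by case/andP: u01.
have le2 j : (1 < j)%N -> 2 * u <= gamma u j.
  by move=> j1; apply: le_trans (le_muln_gamma j); rewrite ler_wpM2r ?ler_nat.
have ha := ler_wpM2r (gamma_ge0 b) (le2 _ a1).
have hb := ler_wpM2l (gamma_ge0 a) (le2 _ b1).
move: ha hb; move: (gamma u a) (gamma u b) => x y ha hb; lra.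
Qed.

(** [t] is within [gamma u j] of 1, as is a product of [j] roundoff factors. *)
Definition relerr (j : nat) (t : R[i]) : Prop := cabs (t - 1) <= gamma u j.

Lemma relerr1 j : relerr j 1.
Proof. by rewrite /relerr subrr cabs0 gamma_ge0. Qed.

Lemma relerr_mono a b t : (a <= b)%N -> relerr a t -> relerr b t.
Proof. by move=> ab h; apply: le_trans h (gamma_mono ab). Qed.

Lemma relerrM a b s t : relerr a s -> relerr b t -> relerr (a + b) (s * t).
Proof.
rewrite /relerr => hs ht; rewrite -gamma_sum.
have -> : s * t - 1 = (s - 1) + (t - 1) + (s - 1) * (t - 1) by ring.
apply: le_trans (cabsD _ _) _; apply: lerD.
  by apply: le_trans (cabsD _ _) _; apply: lerD.
by rewrite cabsM ler_pM ?cabs_ge0.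
Qed.

Lemma relerr_conj j t : relerr j t -> relerr j t^*.
Proof.
rewrite /relerr => h; have -> : t^* - 1 = (t - 1)^* by rewrite rmorphB rmorph1.
by rewrite cabs_conj.
Qed.

Lemma fl_relerr (x y : R[i]) : fl u x y -> exists2 t, relerr 1 t & y = x * t.
Proof.
case=> th hth ->; exists (1 + th) => //.
by rewrite /relerr addrAC subrr add0r (le_trans hth) // le_u_gamma1.
Qed.

Lemma fl_sum_relerr n (p : 'I_n -> R[i]) (I : {set 'I_n}) (s : R[i]) :
  fl_sum u p I s -> exists2 t : 'I_n -> R[i], forall k, relerr #|I|.-1 (t k) &
    s = \sum_(k in I) p k * t k.
Proof.
elim=> {I s} [|i|I J a b c I0 J0 dIJ _ [t ht ->] _ [t' ht' ->]
  /fl_relerr [th hth ->]].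
- by exists (fun=> 1) => [k|]; [exact: relerr1 | rewrite big_set0].
- by exists (fun=> 1) => [k|]; [exact: relerr1 | rewrite big_set1 mulr1].
have cI : (0 < #|I|)%N by rewrite card_gt0.
have cJ : (0 < #|J|)%N by rewrite card_gt0.
have cIJ : #|finset.setU I J| = (#|I| + #|J|)%N.
  by apply/eqP; rewrite (leq_card_setU I J).
exists (fun k => (if k \in I then t k else t' k) * th) => [k|].
  case: ifP => _.
    apply: relerr_mono (relerrM (ht k) hth).
    by rewrite cIJ; move: cI cJ; lia.
  apply: relerr_mono (relerrM (ht' k) hth).
  by rewrite cIJ; move: cI cJ; lia.
rewrite [RHS](eq_bigl [in [predU I & J]]); last by move=> k; rewrite finset.in_setU.
rewrite bigU //= mulrDl !mulr_suml; congr (_ + _); apply: eq_bigr => k hk.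
  by rewrite hk mulrA.
by rewrite (disjointFl dIJ hk) mulrA.
Qed.

Lemma fl_dot m n l (M : 'M[R[i]]_(m, n)) (N : 'M[R[i]]_(n, l)) Ch :
  fl_mulmx u M N Ch -> forall i j,
  exists2 t : 'I_n -> R[i], forall k, relerr n (t k) &
    Ch i j = \sum_k M i k * N k j * t k.
Proof.
move=> h i j; have [p hp /fl_sum_relerr [t ht ->]] := h i j.
have [q hq] : {q | forall k, relerr 1 (q k) /\ p k = M i k * N k j * q k}.
  have [k|q hq] := @choice _ _ (fun k z => relerr 1 z /\ p k = M i k * N k j * z).
    by have [z] := fl_relerr (hp k); exists z.
  by exists q.
exists (fun k => q k * t k) => [k|].
  have n_gt0 : (0 < n)%N := leq_ltn_trans (leq0n k) (ltn_ord k).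
  have := relerrM (hq k).1 (ht k).
  by rewrite cardsT card_ord add1n prednK.
by apply: eq_big => [k|k _]; rewrite ?finset.in_setT // (hq k).2 -mulrA.
Qed.

(** [N] is obtained from [M] by a componentwise relative perturbation of
    size at most [gamma u j]. *)
Definition relmx (j m n : nat) (M N : 'M[R[i]]_(m, n)) : Prop :=
  forall a b, exists2 t, relerr j t & N a b = M a b * t.

Lemma relmx_trans i j m n (M N K : 'M[R[i]]_(m, n)) :
  relmx i M N -> relmx j N K -> relmx (i + j) M K.
Proof.
move=> h1 h2 a b; have [s hs Es] := h1 a b; have [t ht Et] := h2 a b.
by exists (s * t); rewrite ?Et ?Es ?mulrA //; apply: relerrM.
Qed.

Lemma relmx_adj j m n (M N : 'M[R[i]]_(m, n)) :
  relmx j M N -> relmx j (M ^t*) (N ^t*).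
Proof.
move=> h a b; have [t ht Et] := h b a; exists t^*; first exact: relerr_conj.
by rewrite !mxE Et rmorphM.
Qed.

Lemma relmx_normF j m n (M N : 'M[R[i]]_(m, n)) :
  relmx j M N -> normF (N - M) <= gamma u j * normF M.
Proof.
move=> h; apply: normF_entrywise => [|a b]; first exact: gamma_ge0.
have [t ht Et] := h a b; rewrite !mxE Et -[X in _ - X]mulr1 -mulrBr cabsM mulrC.
by rewrite ler_wpM2r ?cabs_ge0.
Qed.

Lemma fl_submx_relmx m n (M N K : 'M[R[i]]_(m, n)) :
  fl_submx u M N K -> relmx 1 (M - N) K.
Proof. by move=> h a b; rewrite !mxE; exact: fl_relerr (h a b). Qed.

Lemma fl_submx_normF m n (M N K : 'M[R[i]]_(m, n)) :
  fl_submx u M N K -> normF (K - (M - N)) <= u * normF (M - N).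
Proof.
move=> h; apply: normF_entrywise => [|a b]; first by case/andP: u01.
have [th hth E] := h a b; rewrite !mxE E mulrDr mulr1 addrAC subrr add0r.
by rewrite cabsM mulrC ler_wpM2r ?cabs_ge0.
Qed.

Lemma fl_mulmx_backward m n (M : 'M[R[i]]_(m, n)) (x : 'cV[R[i]]_n) y :
  fl_mulmx u M x y -> exists2 N, relmx n M N & y = N *m x.
Proof.
move=> h; have [t ht] : {t : 'I_m -> 'I_n -> R[i] | forall a,
    (forall k, relerr n (t a k)) /\ y a 0 = \sum_k M a k * x k 0 * t a k}.
  have [a|t ht] := @choice _ _ (fun a (z : 'I_n -> R[i]) =>
      (forall k, relerr n (z k)) /\ y a 0 = \sum_k M a k * x k 0 * z k).
    by have [z] := fl_dot h a 0; exists z.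
  by exists t.
exists (\matrix_(a, k) (M a k * t a k)) => [a k|].
  by exists (t a k); rewrite ?mxE //; exact: (ht a).1.
apply/matrixP => a b; rewrite ord1 (ht a).2 mxE; apply: eq_bigr => k _.
by rewrite mxE mulrAC.
Qed.

Lemma fl_mulmx_forward m n l (M : 'M[R[i]]_(m, n)) (N : 'M[R[i]]_(n, l)) K :
  fl_mulmx u M N K -> normF (K - M *m N) <= gamma u n * (normF M * normF N).
Proof.
move=> h; apply: normF_entrywise_mul => [|a b]; first exact: gamma_ge0.
have [t ht E] := fl_dot h a b; rewrite !mxE E -sumrB mulr_sumr.
apply: le_trans (cabs_sum _ _ _) _; apply: ler_sum => k _.
rewrite -[X in _ - X]mulr1 -mulrBr !cabsM mulrC.
by rewrite ler_wpM2r ?mulr_ge0 ?cabs_ge0 //; exact: ht.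
Qed.

End Rounding.

Opaque norm2 normF cabs mulmx map_mx trmx scalar_mx invmx addmx oppmx.
(** * Block reflectors *)

(** The operator [I - W T^-1 W^*]. *)
Definition house (R : realType) (n k : nat) (W : 'M[R[i]]_(n, k))
  (T : 'M[R[i]]_k) : 'M[R[i]]_n := 1%:M - W *m invmx T *m W ^t*.

Section HouseAlgebra.
Variables (K : comUnitRingType) (n k : nat).
Implicit Types (W D : 'M[K]_(n, k)) (X Y : 'M[K]_(k, n)) (T U : 'M[K]_k).

Lemma inv_gram_algebra T S E : T \in unitmx -> S \in unitmx ->
  invmx T *m (T + S + E) *m invmx S =
  invmx S + invmx T + invmx T *m E *m invmx S.
Proof.
move=> uT uS; rewrite !mulmxDr !mulmxDl (mulVmx uT) mul1mx.
by rewrite -[invmx T *m S *m _]mulmxA (mulmxV uS) mulmx1.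
Qed.

(** The defect of unitarity of [I - W T^-1 W^*]. *)
Lemma house_gram_algebra W X T S : T \in unitmx -> S \in unitmx ->
  (1%:M - W *m invmx S *m X) *m (1%:M - W *m invmx T *m X) - 1%:M =
  (W *m invmx S) *m (X *m W - (T + S)) *m (invmx T *m X).
Proof.
move=> uT uS.
have -> : W *m invmx S *m (X *m W - (T + S)) *m (invmx T *m X) =
    W *m invmx S *m X *m (W *m invmx T *m X) -
      (W *m invmx S *m X + W *m invmx T *m X).
  rewrite mulmxBr mulmxBl; congr (_ - _); first by rewrite !mulmxA.
  rewrite mulmxDr mulmxDl; congr (_ + _); last by rewrite mulmxKV // mulmxA.
  by rewrite -!mulmxA mulKVmx.
rewrite mulmxBl mul1mx mulmxBr mulmx1.
move: (W *m invmx T *m X) (W *m invmx S *m X) (_ *m X *m _) => A B C.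
by apply/matrixP => i j; rewrite !mxE; ring.
Qed.

Lemma house_perturb_algebra W D X Y T U : T \in unitmx -> U \in unitmx ->
  (1%:M - (W + D) *m invmx U *m (X + Y)) - (1%:M - W *m invmx T *m X) =
  (W *m invmx T) *m (U - T) *m (invmx U *m X) - D *m (invmx U *m X) -
  (W *m invmx U) *m Y - D *m invmx U *m Y.
Proof.
move=> uT uU.
have -> : W *m invmx T *m (U - T) *m (invmx U *m X) =
    W *m invmx T *m X - W *m invmx U *m X.
  rewrite mulmxBr mulmxBl; congr (_ - _); last by rewrite mulmxKV // mulmxA.
  by rewrite -!mulmxA mulKVmx.
rewrite !mulmxDl !mulmxDr !mulmxA.
move: (W *m invmx T *m X) (W *m invmx U *m X) (W *m _ *m Y) => A B C.
move: (D *m _ *m X) (D *m _ *m Y) => F G.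
by apply/matrixP => i j; rewrite !mxE; ring.
Qed.

End HouseAlgebra.

Section House.
Variable R : realType.
Variables n k : nat.
Implicit Types (W D : 'M[R[i]]_(n, k)) (T U : 'M[R[i]]_k).

Lemma house_adj W T : (house W T) ^t* = house W (T ^t*).
Proof. by rewrite /house ctmxD ctmxN ctmx1 !ctmxM ctmxK ctmx_inv mulmxA. Qed.

Lemma norm2_adjB T U : norm2 (U ^t* - T ^t*) = norm2 (U - T).
Proof. by rewrite -ctmxN -ctmxD norm2_adj. Qed.

Lemma norm2_inv_adj T : norm2 (invmx (T ^t*)) = norm2 (invmx T).
Proof. by rewrite -ctmx_inv norm2_adj. Qed.

(** [U^-1 W^* W U^-* = U^-* + U^-1 + U^-1 E U^-*] when
    [W^* W = U + U^* + E]. *)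
Lemma norm2_inv_mul_adj W U (t e a : R) : U \in unitmx ->
  norm2 (W ^t* *m W - (U + U ^t*)) <= e -> norm2 (invmx U) <= t ->
  0 <= a -> 2 * t + t ^+ 2 * e <= a ^+ 2 -> norm2 (invmx U *m W ^t*) <= a.
Proof.
move=> uU hE ht a0 ha; apply: norm2_gram_adj a0 _; apply: le_trans ha.
set E := (X in norm2 X) in hE.
have -> : invmx U *m W ^t* *m (invmx U *m W ^t*) ^t* =
    invmx (U ^t*) + invmx U + invmx U *m E *m invmx (U ^t*).
  rewrite ctmxM ctmxK ctmx_inv mulmxA -(mulmxA _ (W ^t*)).
  have -> : W ^t* *m W = U + U ^t* + E by rewrite /E addrC subrK.
  have uU' : U ^t* \in unitmx by rewrite ctmx_unit.
  exact: inv_gram_algebra.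
have -> : 2 * t + t ^+ 2 * e = t + t + t * e * t by ring.
have ht' : norm2 (invmx (U ^t*)) <= t by rewrite norm2_inv_adj.
exact: norm2D (norm2D ht' ht) (norm2M (norm2M ht hE) ht').
Qed.

Lemma norm2_mul_inv W U (t e a : R) : U \in unitmx ->
  norm2 (W ^t* *m W - (U + U ^t*)) <= e -> norm2 (invmx U) <= t ->
  0 <= a -> 2 * t + t ^+ 2 * e <= a ^+ 2 -> norm2 (W *m invmx U) <= a.
Proof.
move=> uU hE ht a0 ha; rewrite -norm2_adj ctmxM ctmx_inv.
have uU' : U ^t* \in unitmx by rewrite ctmx_unit.
have ht' : norm2 (invmx (U ^t*)) <= t by rewrite norm2_inv_adj.
by apply: norm2_inv_mul_adj uU' _ ht' a0 ha; rewrite ctmxK [U ^t* + _]addrC.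
Qed.

Section NearUnitary.
Variables (W : 'M[R[i]]_(n, k)) (T : 'M[R[i]]_k) (d e1 eta : R).
Hypotheses (uT : T \in unitmx) (d_ge0 : 0 <= d) (le_d_e1 : d <= e1).
Hypothesis hE : norm2 (W ^t* *m W - (T + T ^t*)) <= d.
Hypothesis eta_ge0 : 0 <= eta.
Hypothesis heta :
  4 * norm2 (invmx T) + 4 * norm2 (invmx T) ^+ 2 * e1 <= eta ^+ 2.

Let heta0 : 2 * norm2 (invmx T) + norm2 (invmx T) ^+ 2 * d <= eta ^+ 2.
Proof.
apply: le_trans heta.
have h1 := norm2_ge0 (invmx T).
have h2 := ler_wpM2l (sqr_ge0 (norm2 (invmx T))) le_d_e1.
have h3 := mulr_ge0 (sqr_ge0 (norm2 (invmx T))) (le_trans d_ge0 le_d_e1).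
move: h1 h2 h3; move: (norm2 _) => t h1 h2 h3; lra.
Qed.

Lemma norm2_house_W_inv : norm2 (W *m invmx T) <= eta.
Proof. exact: norm2_mul_inv uT hE (lexx _) eta_ge0 heta0. Qed.

Lemma norm2_house_inv_W : norm2 (invmx T *m W ^t*) <= eta.
Proof. exact: norm2_inv_mul_adj uT hE (lexx _) eta_ge0 heta0. Qed.

Lemma house_near_unitary :
  norm2 ((house W T) ^t* *m house W T - 1%:M) <= d * eta ^+ 2.
Proof.
have uT' : T ^t* \in unitmx by rewrite ctmx_unit.
rewrite house_adj (house_gram_algebra W (W ^t*) uT uT').
have h : norm2 (W *m invmx (T ^t*)) <= eta.
  by have := norm2_house_inv_W; rewrite -norm2_adj ctmxM ctmxK ctmx_inv.
have -> : d * eta ^+ 2 = eta * d * eta by ring.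
exact: norm2M (norm2M h hE) norm2_house_inv_W.
Qed.

Lemma norm2_house : norm2 (house W T) <= Num.sqrt (1 + d * eta ^+ 2).
Proof.
apply: norm2_near_iso house_near_unitary (sqrtr_ge0 _) _.
by rewrite sqr_sqrtr // addr_ge0 // mulr_ge0 // sqr_ge0.
Qed.

Section Perturbed.
Variables (D : 'M[R[i]]_(n, k)) (U : 'M[R[i]]_k) (w om dT : R).
Hypotheses (hW : norm2 W <= w) (hD : norm2 D <= om) (hU : norm2 (U - T) <= dT).
Hypotheses (om_ge0 : 0 <= om) (dT_ge0 : 0 <= dT).
Hypothesis he1 : d + 2 * dT + 2 * w * om + om ^+ 2 <= e1.
Hypothesis hdT : dT * norm2 (invmx T) <= 1 / 2.

Let U_inv : U \in unitmx /\ norm2 (invmx U) <= 2 * norm2 (invmx T).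
Proof.
apply: perturbed_inverse uT _; apply: le_trans hdT.
exact: ler_pM (norm2_ge0 _) (norm2_ge0 _) hU (lexx _).
Qed.

Lemma house_perturbed_unit : U \in unitmx.
Proof. exact: U_inv.1. Qed.

Let hE1 : norm2 (W ^t* *m W - (U + U ^t*)) <= d + 2 * dT.
Proof.
have -> : W ^t* *m W - (U + U ^t*) =
    W ^t* *m W - (T + T ^t*) - ((U - T) + (U - T) ^t*).
  rewrite ctmxD ctmxN; move: (W ^t* *m W) (U ^t*) (T ^t*) => A B C.
  by apply/matrixP => i j; rewrite !mxE; ring.
apply: norm2B hE _; rewrite mulr2n mulrDl mul1r.
by apply: norm2D hU _; rewrite norm2_adj.
Qed.

Let hE2 : norm2 ((W + D) ^t* *m (W + D) - (U + U ^t*)) <= e1.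
Proof.
have -> : (W + D) ^t* *m (W + D) - (U + U ^t*) =
    W ^t* *m W - (U + U ^t*) + (W ^t* *m D + D ^t* *m W) + D ^t* *m D.
  rewrite ctmxD mulmxDl !mulmxDr.
  move: (_ *m W) (U + U ^t*) (_ *m D) (D ^t* *m W) (D ^t* *m D) => A B C E F.
  by apply/matrixP => i j; rewrite !mxE; ring.
apply: le_trans he1.
have hW' : norm2 (W ^t*) <= w by rewrite norm2_adj.
have hD' : norm2 (D ^t*) <= om by rewrite norm2_adj.
have -> : d + 2 * dT + 2 * w * om + om ^+ 2 =
    d + 2 * dT + (w * om + om * w) + om * om by ring.
exact: norm2D (norm2D hE1 (norm2D (norm2M hW' hD) (norm2M hD' hW))) (norm2M hD' hD).
Qed.

Let eta_U e : e <= e1 ->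
  2 * (2 * norm2 (invmx T)) + (2 * norm2 (invmx T)) ^+ 2 * e <= eta ^+ 2.
Proof.
move=> le_e; apply: le_trans heta.
have h2 := ler_wpM2l (sqr_ge0 (norm2 (invmx T))) le_e.
move: h2; move: (norm2 _) => t h2; lra.
Qed.

Let le_e1 : d + 2 * dT <= e1.
Proof.
apply: le_trans he1; rewrite -addrA lerDl.
have w0 : 0 <= w := le_trans (norm2_ge0 W) hW.
by rewrite addr_ge0 ?sqr_ge0 // mulr_ge0 // mulr_ge0.
Qed.

Lemma norm2_perturbed_inv_W : norm2 (invmx U *m (W + D) ^t*) <= eta.
Proof.
exact: norm2_inv_mul_adj U_inv.1 hE2 U_inv.2 eta_ge0 (eta_U (lexx _)).
Qed.

Lemma norm2_perturbed_W_inv : norm2 ((W + D) *m invmx U) <= eta.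
Proof. exact: norm2_mul_inv U_inv.1 hE2 U_inv.2 eta_ge0 (eta_U (lexx _)). Qed.

Lemma house_perturbed : norm2 (house (W + D) U - house W T) <=
  (dT + om ^+ 2) * eta ^+ 2 + 2 * om * eta.
Proof.
have [uU hUi] := U_inv.
have hD' : norm2 (D ^t*) <= om by rewrite norm2_adj.
have h1 : norm2 (invmx U *m W ^t*) <= eta.
  exact: norm2_inv_mul_adj uU hE1 hUi eta_ge0 (eta_U le_e1).
have h2 : norm2 (W *m invmx U) <= eta.
  exact: norm2_mul_inv uU hE1 hUi eta_ge0 (eta_U le_e1).
rewrite /house ctmxD (house_perturb_algebra W D (W ^t*) (D ^t*) uT uU).
have a1 := norm2M (norm2M norm2_house_W_inv hU) h1.
have a2 := norm2M hD h1.
have a3 := norm2M h2 hD'.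
have a4 := norm2M (norm2M hD hUi) hD'.
apply: le_trans (norm2B (norm2B (norm2B a1 a2) a3) a4) _.
(* [‖U^-1‖ <= 2 ‖T^-1‖ <= eta ^ 2] bounds the term of second order in [D] *)
have h3 : 2 * norm2 (invmx T) <= eta ^+ 2.
  apply: le_trans (eta_U (lexx e1)).
  have h4 : 0 <= (2 * norm2 (invmx T)) ^+ 2 * e1.
    by rewrite mulr_ge0 ?sqr_ge0 // (le_trans d_ge0).
  apply: le_trans (_ : 2 * (2 * norm2 (invmx T)) <= _); last by rewrite lerDl.
  by rewrite ler_peMl ?mulr_ge0 ?norm2_ge0 // ler1n.
have -> : (dT + om ^+ 2) * eta ^+ 2 + 2 * om * eta =
    eta * dT * eta + om * eta + eta * om + om ^+ 2 * eta ^+ 2 by ring.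
rewrite lerD2l [leLHS]mulrAC -expr2.
by apply: ler_wpM2l h3; exact: sqr_ge0.
Qed.

End Perturbed.
End NearUnitary.
End House.

(** * Application of a block reflector in floating-point arithmetic *)

Section FlApply.
Variables (R : realType) (u : R).
Hypothesis u01 : 0 <= u < 1.
Variables (n k : nat) (W Wh : 'M[R[i]]_(n, k)) (T Th : 'M[R[i]]_k).
Variables (d e1 eta w wF eT esv : R).
Let dT := eT + 3 * esv * (1 + eT).
Let om := wF * gamma u (k + 1).
Let e2 := (dT + om ^+ 2) * eta ^+ 2 + 2 * om * eta.
Let h := Num.sqrt (1 + d * eta ^+ 2).
Let e3 := wF * gamma u (n + 2 * k + 1) * eta + u * (h + e2).
Hypotheses (uT : T \in unitmx) (d_ge0 : 0 <= d).
Hypothesis hE : norm2 (W ^t* *m W - (T + T ^t*)) <= d.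
Hypothesis eta_ge0 : 0 <= eta.
Hypothesis heta :
  4 * norm2 (invmx T) + 4 * norm2 (invmx T) ^+ 2 * e1 <= eta ^+ 2.
Hypotheses (hW : norm2 W <= w) (hWF : normF W <= wF).
Hypotheses (eT_ge0 : 0 <= eT) (esv_ge0 : 0 <= esv).
Hypothesis he1 : d + 2 * dT + 2 * w * om + om ^+ 2 <= e1.
Hypothesis hdT : dT * norm2 (invmx T) <= 1 / 2.
Hypotheses (hT3 : norm2 T <= 3) (hTh : norm2 (Th - T) <= eT).
Hypotheses (hWh : relmx u 1 W Wh) (le_kn : (k <= n)%N).
(* For [k = 0] the index bound behind [e3] fails, but then [W] is empty. *)
Hypothesis wF0 : k = 0%N -> wF = 0.

Let wF_ge0 : 0 <= wF := le_trans (normF_ge0 W) hWF.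

Let om_ge0 : 0 <= om.
Proof. by rewrite mulr_ge0 // gamma_ge0. Qed.

Let dT_ge0 : 0 <= dT.
Proof. by rewrite addr_ge0 // !mulr_ge0 // addr_ge0. Qed.

Let le_d_e1 : d <= e1.
Proof.
apply: le_trans he1; rewrite -!addrA lerDl.
have w0 : 0 <= w := le_trans (norm2_ge0 W) hW.
apply: addr_ge0; first exact: mulr_ge0.
by apply: addr_ge0 (sqr_ge0 _); apply: mulr_ge0 => //; apply: mulr_ge0.
Qed.

(** One column: the computed value is the exact image under a reflector built
    from perturbed [W + D] and [U], up to a forward error. The backward errors
    of the products with [W^*] and with [W] differ; the one of the latter is
    kept as [D], and the difference goes into the forward error. *)
Lemma fl_apply_house (x xh : 'cV[R[i]]_n) : fl_apply u esv Wh Th x xh ->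
  exists D U, [/\ norm2 D <= om, norm2 (U - T) <= dT &
    normF (xh - house (W + D) U *m x) <= e3 * normF x].
Proof.
case=> y [z [v [hy [dM hdM hz] hv hx]]].
have [N1 hN1 Ey] := fl_mulmx_backward u01 hy.
have [N2 hN2 Ev] := fl_mulmx_backward u01 hv.
have hN1' := relmx_trans (relmx_adj hWh) hN1.
have hN2' := relmx_trans hWh hN2.
pose D := N2 - W; pose U := Th + dM.
have hDF : normF D <= om.
  apply: le_trans (relmx_normF u01 hN2') _.
  by rewrite addnC mulrC ler_wpM2r ?gamma_ge0.
have hD : norm2 D <= om := le_trans (norm2_le_normF D) hDF.
have hThn : norm2 Th <= 3 + eT.
  by rewrite -(subrK T Th) addrC; exact: norm2D.
have hU : norm2 (U - T) <= dT.
  have -> : U - T = (Th - T) + dM by rewrite /U addrAC.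
  apply: norm2D hTh _; apply: le_trans hdM _.
  apply: le_trans (ler_wpM2l esv_ge0 hThn) _.
  rewrite [3 * esv]mulrC -mulrA ler_wpM2l // mulrDr mulr1 lerD2l.
  by rewrite ler_peMl // ler1n.
exists D, U; split=> //.
have uU := house_perturbed_unit uT hU hdT.
have E : x - v - house (W + D) U *m x =
    (W + D) *m invmx U *m (((W + D) ^t* - N1) *m x).
  have -> : W + D = N2 by rewrite /D addrC subrK.
  have Ez : z = invmx U *m (N1 *m x) by rewrite -Ey -hz mulKmx.
  rewrite Ev Ez /house mulmxBl mul1mx mulmxBl mulmxBr !mulmxA.
  by rewrite opprB addrC addrA subrK addrC.
have hDN : normF ((W + D) ^t* - N1) <= wF * (gamma u (k + 1) + gamma u (n + 1)).
  have -> : (W + D) ^t* - N1 = D ^t* - (N1 - W ^t*).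
    by rewrite ctmxD opprB addrA (addrC (D ^t*)).
  apply: le_trans (normFB _ _) _; rewrite normF_adj mulrDr; apply: lerD => //.
  apply: le_trans (relmx_normF u01 hN1') _.
  by rewrite normF_adj addnC mulrC ler_wpM2r ?gamma_ge0.
set g := wF * _ in hDN.
have hs : normF (x - v - house (W + D) U *m x) <= eta * g * normF x.
  rewrite E -mulrA; apply: normF_mulv_le.
    exact: (norm2_perturbed_W_inv uT hE eta_ge0 heta hW hD hU).
  apply: normF_mulv_le (lexx _).
  exact: le_trans (norm2_le_normF _) hDN.
have hH : norm2 (house (W + D) U) <= h + e2.
  rewrite -(subrK (house W T) (house _ _)) addrC; apply: norm2D.
    exact: (norm2_house uT d_ge0 le_d_e1 hE eta_ge0 heta).
  exact: (house_perturbed uT d_ge0 le_d_e1 hE eta_ge0 heta hW hD hU).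
have hxv : normF (x - v) <= (h + e2 + eta * g) * normF x.
  rewrite -(subrK (house (W + D) U *m x) (x - v)) addrC mulrDl.
  by apply: le_trans (normFD _ _) (lerD _ hs); exact: normF_mulv_le.
have hlast := fl_submx_normF u01 hx.
have -> : xh - house (W + D) U *m x =
    (xh - (x - v)) + (x - v - house (W + D) U *m x).
  by rewrite (addrA (xh - _)) subrK.
apply: le_trans (normFD _ _) _; apply: le_trans (lerD hlast hs) _.
have u0 : 0 <= u by case/andP: u01.
apply: le_trans (lerD (ler_wpM2l u0 hxv) (lexx _)) _.
have hg : (1 + u) * g <= wF * gamma u (n + 2 * k + 1).
  have [k0|k_gt0] := posnP k; first by rewrite /g wF0 // !mul0r mulr0.
  rewrite /g mulrCA ler_wpM2l //.
  have ha : (1 < k + 1)%N by rewrite addn1.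
  have hb : (1 < n + 1)%N by rewrite addn1 ltnS (leq_trans k_gt0).
  apply: le_trans (gamma_round_sum u01 ha hb) _; apply: (gamma_mono u01).
  by move: k_gt0; clear; lia.
rewrite mulrA -mulrDl; apply: ler_wpM2r; first exact: normF_ge0.
have := ler_wpM2l eta_ge0 hg; rewrite /e3.
move: (wF * gamma u (n + 2 * k + 1)) (h + e2) => p q hp.
have -> : u * (q + eta * g) + eta * g = eta * ((1 + u) * g) + u * q by ring.
by rewrite lerD2r [p * _]mulrC.
Qed.

Lemma fl_apply_forward (x xh : 'cV[R[i]]_n) : fl_apply u esv Wh Th x xh ->
  normF (xh - house W T *m x) <= (e2 + e3) * normF x.
Proof.
move=> /fl_apply_house [D [U [hD hU hx]]].
rewrite -(subrK (house (W + D) U *m x) xh) -addrA -mulmxBl addrC mulrDl.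
apply: le_trans (normFD _ _) (lerD _ hx); apply: normF_mulv_le (lexx _).
exact: (house_perturbed uT d_ge0 le_d_e1 hE eta_ge0 heta hW hD hU).
Qed.

End FlApply.

(** * The two-stage algorithm in exact arithmetic *)

Section TwoStageExact.
Variables (R : realType) (k0 m : nat).
Variables (V : 'M[R[i]]_(k0 + m, k0)) (P : 'M[R[i]]_k0).
Let T := exactT V P.

(** The exact value of the variable [W] of the algorithm. *)
Definition exactW : 'M[R[i]]_(k0 + m, k0) := col_mx P 0 - V.
Let W := exactW.

Lemma ctmx_col_mx l (M : 'M[R[i]]_(k0, l)) (N : 'M[R[i]]_(m, l)) :
  (col_mx M N) ^t* = row_mx (M ^t*) (N ^t*).
Proof. by rewrite tr_col_mx map_row_mx. Qed.

Lemma ctmx0 l p : (0 : 'M[R[i]]_(l, p)) ^t* = 0.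
Proof. by rewrite trmx0 map_mx0. Qed.

Lemma mul_ctmx_col_mx0 l p (M : 'M[R[i]]_(k0, l)) (N : 'M[R[i]]_(k0 + m, p)) :
  (col_mx M (0 : 'M_(m, l))) ^t* *m N = M ^t* *m usubmx N.
Proof.
by rewrite ctmx_col_mx ctmx0 -{1}(vsubmxK N) mul_row_col mul0mx addr0.
Qed.

Lemma mul_ctmx_col_0mx l p (M : 'M[R[i]]_(m, l)) (N : 'M[R[i]]_(k0 + m, p)) :
  (col_mx (0 : 'M_(k0, l)) M) ^t* *m N = M ^t* *m dsubmx N.
Proof.
by rewrite ctmx_col_mx ctmx0 -{1}(vsubmxK N) mul_row_col mul0mx add0r.
Qed.

Lemma mul_ctmxr_col_mx0 l p (M : 'M[R[i]]_(k0, l)) (N : 'M[R[i]]_(k0 + m, p)) :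
  N ^t* *m col_mx M (0 : 'M_(m, l)) = (usubmx N) ^t* *m M.
Proof.
have -> : N ^t* *m col_mx M (0 : 'M_(m, l)) =
    ((col_mx M (0 : 'M_(m, l))) ^t* *m N) ^t* by rewrite ctmxM ctmxK.
by rewrite mul_ctmx_col_mx0 ctmxM ctmxK.
Qed.

Lemma exactTE : T = P ^t* *m P - (usubmx V) ^t* *m P.
Proof. by rewrite /T /exactT ctmxD ctmxN mulmxBl. Qed.

Lemma ctmx_exactTE : T ^t* = P ^t* *m P - P ^t* *m usubmx V.
Proof. by rewrite exactTE ctmxD ctmxN !ctmxM !ctmxK. Qed.

Lemma gram_exactW :
  W ^t* *m W - (T + T ^t*) = (V ^t* *m V - 1%:M) - (P ^t* *m P - 1%:M).
Proof.
rewrite ctmx_exactTE exactTE /W /exactW ctmxD ctmxN.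
rewrite mulmxBl (mulmxBr (_ ^t*)) (mulmxBr (V ^t*)).
rewrite !mul_ctmx_col_mx0 mul_ctmxr_col_mx0 col_mxKu.
move: (P ^t* *m P) (P ^t* *m _) (_ *m P) (V ^t* *m V) (1%:M) => A B C E I.
by apply/matrixP => i j; rewrite !mxE; ring.
Qed.

Lemma exactT_addW : T + V ^t* *m W = (P ^t* *m P - 1%:M) - (V ^t* *m V - 1%:M).
Proof.
rewrite exactTE /W /exactW mulmxBr mul_ctmxr_col_mx0.
move: (P ^t* *m P) (_ *m P) (V ^t* *m V) (1%:M) => A B C I.
by apply/matrixP => i j; rewrite !mxE; ring.
Qed.

(** [V^*] and [- W^*] agree on vectors with vanishing leading block. *)
Lemma ctmx_exactW_col_0mx l (q : 'M[R[i]]_(m, l)) :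
  V ^t* *m col_mx 0 q = - (W ^t* *m col_mx 0 q).
Proof.
rewrite /W /exactW ctmxD ctmxN mulmxBl mul_ctmx_col_mx0 col_mxKu mulmx0.
by rewrite sub0r opprK.
Qed.

Hypothesis uT : T \in unitmx.

Lemma exactT_unit_P : P \in unitmx.
Proof. by move: uT; rewrite /T /exactT unitmx_mul => /andP[]. Qed.

(** The reflector maps the leading coordinates to the column space of [V]. *)
Lemma house_col_mx0 l (M : 'M[R[i]]_(k0, l)) :
  house W T *m col_mx M 0 = V *m (invmx P *m M).
Proof.
rewrite /house mulmxBl mul1mx -(mulmxA _ (W ^t*)) mul_ctmxr_col_mx0.
have -> : (usubmx W) ^t* = T *m invmx P.
  rewrite /T /exactT -mulmxA (mulmxV exactT_unit_P) mulmx1.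
  by rewrite /W /exactW linearB /= col_mxKu.
rewrite -(mulmxA W) -(mulmxA T) (mulKmx uT) /W /exactW mulmxBl mul_col_mx mul0mx.
by rewrite (mulKVmx exactT_unit_P) opprB addrC subrK.
Qed.

End TwoStageExact.

(** * Loss of orthogonality *)

Section Bounds.
Variable R : realType.

Lemma normF_cols_le n p k (M : 'M[R[i]]_(n, k)) (N : 'M[R[i]]_(p, k)) (a : R) :
  0 <= a -> (forall j, normF (col j M) <= a * normF (col j N)) ->
  normF M <= a * normF N.
Proof.
move=> a0 h; apply: normF_le_sqr; first by rewrite mulr_ge0 // normF_ge0.
rewrite exprMn !normF_sqr_col mulr_sumr; apply: ler_sum => j _; rewrite -exprMn.
by rewrite ler_pXn2r ?nnegrE ?normF_ge0 // mulr_ge0 // normF_ge0.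
Qed.

Lemma perturbed_gram_algebra (K : pzRingType) n k (G : 'M[K]_(k, n))
    (F : 'M[K]_(n, k)) (B : 'M[K]_(k, n)) (D : 'M[K]_(n, k)) :
  (G + B) *m (F + D) - 1%:M = (G *m F - 1%:M) + (G *m D + B *m F) + B *m D.
Proof.
rewrite mulmxDl !mulmxDr; move: (G *m F) (G *m D) (B *m F) (B *m D) (1%:M).
move=> X Y Z T I; rewrite -!addrA; congr (_ + _).
by rewrite [RHS]addrCA; congr (_ + _); rewrite [RHS]addrC -!addrA.
Qed.

(** Loss of orthogonality of a perturbation [Q] of [H X]. *)
Lemma orthogonality_bound n k (H : 'M[R[i]]_n) (X Q : 'M[R[i]]_(n, k))
    (eo a e4 : R) :
  0 <= a -> 0 <= e4 -> norm2 (X ^t* *m X - 1%:M) <= eo ->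
  norm2 X <= Num.sqrt 2 ->
  norm2 (H ^t* *m H - 1%:M) <= a -> norm2 H <= Num.sqrt (1 + a) ->
  normF (Q - H *m X) <= e4 * normF X ->
  norm2 (Q ^t* *m Q - 1%:M) <=
    eo + 2 * (a + 2 * Num.sqrt (k%:R * (1 + a)) * e4 + k%:R * e4 ^+ 2).
Proof.
move=> a0 e0 heo hX hHH hH hQ.
have hD : norm2 (Q - H *m X) <= e4 * (Num.sqrt k%:R * Num.sqrt 2).
  apply: le_trans (norm2_le_normF _) _; apply: le_trans hQ _.
  apply: (ler_wpM2l e0); apply: le_trans (normF_le_cols _) _.
  exact: ler_wpM2l (sqrtr_ge0 _) _ _ hX.
set D := Q - H *m X in hD.
have hHX := norm2M hH hX.
have -> : Q = H *m X + D by rewrite /D addrC subrK.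
have hHX' : norm2 ((H *m X) ^t*) <= Num.sqrt (1 + a) * Num.sqrt 2.
  by rewrite norm2_adj.
have hD' : norm2 (D ^t*) <= e4 * (Num.sqrt k%:R * Num.sqrt 2) by rewrite norm2_adj.
have hX' : norm2 (X ^t*) <= Num.sqrt 2 by rewrite norm2_adj.
have hHXX : norm2 ((H *m X) ^t* *m (H *m X) - 1%:M) <=
    eo + Num.sqrt 2 * a * Num.sqrt 2.
  have -> : (H *m X) ^t* *m (H *m X) - 1%:M =
      (X ^t* *m X - 1%:M) + X ^t* *m (H ^t* *m H - 1%:M) *m X.
    by rewrite ctmxM mulmxBr mulmxBl mulmx1 !mulmxA [RHS]addrC addrA subrK.
  exact: norm2D heo (norm2M (norm2M hX' hHH) hX).
rewrite ctmxD perturbed_gram_algebra.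
apply: le_trans (norm2D (norm2D hHXX
  (norm2D (norm2M hHX' hD) (norm2M hD' hHX))) (norm2M hD' hD)) _.
rewrite (sqrtrM (1 + a)) ?ler0n //.
have s2 : Num.sqrt 2 ^+ 2 = 2 :> R by rewrite sqr_sqrtr // ler0n.
have sk : Num.sqrt k%:R ^+ 2 = k%:R :> R by rewrite sqr_sqrtr // ler0n.
rewrite -[X in _ + 2 * (_ + X * _)]sk.
move: (Num.sqrt 2) s2 (Num.sqrt k%:R) (Num.sqrt (1 + a)) => s hs kk hh.
set A := leLHS.
have -> : A = eo + s ^+ 2 * (a + 2 * (kk * hh) * e4 + kk ^+ 2 * e4 ^+ 2).
  by rewrite /A; ring.
by rewrite hs.
Qed.

End Bounds.

(** The expansion behind the bound on [V^* Q], with [X] in the role of [W^*]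
    and [Z] in that of [V^*]. *)
Lemma mul_house_algebra (K : comUnitRingType) n k p (Z X : 'M[K]_(k, n))
    (W : 'M[K]_(n, k)) (U : 'M[K]_k) (x : 'M[K]_(n, p)) : U \in unitmx ->
  Z *m ((1%:M - W *m invmx U *m X) *m x) =
  Z *m x + X *m x - (U + Z *m W) *m (invmx U *m X *m x).
Proof.
move=> uU; rewrite mulmxBl mul1mx mulmxBr (mulmxDl U) -!mulmxA (mulKVmx uU).
by rewrite opprD addrA addrK.
Qed.

Lemma qr_ineq (R : realFieldType) (eo er X Y : R) : 0 <= X -> 0 <= Y ->
  eo <= 1 / 8 -> 0 <= er -> er <= 1 / 8 ->
  (1 - eo) * X <= (1 + er) ^+ 2 * Y -> X <= 2 * Y.
Proof.
move=> X0 Y0 heo er0 her h.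
have h1 : (1 + er) ^+ 2 * Y <= 81 / 64 * Y by apply: (ler_wpM2r Y0); nra.
have h2 : 7 / 8 * X <= (1 - eo) * X by apply: (ler_wpM2r X0); lra.
move: h h1 h2; move: (_ ^+ 2 * Y) ((1 - eo) * X) => A B h h1 h2; lra.
Qed.

Section TwoStageBounds.
Variables (R : realType) (k0 m : nat).
Variables (V : 'M[R[i]]_(k0 + m, k0)) (P : 'M[R[i]]_k0).
Let T := exactT V P.
Let W := exactW V P.

Lemma ctmx_house_col_0mx (D : 'M[R[i]]_(k0 + m, k0)) (U : 'M[R[i]]_k0)
    (q : 'cV[R[i]]_m) : U \in unitmx ->
  V ^t* *m (house (W + D) U *m col_mx 0 q) =
  D ^t* *m col_mx 0 q - ((T + V ^t* *m W) + (U - T) + V ^t* *m D) *m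
    (invmx U *m (W + D) ^t* *m col_mx 0 q).
Proof.
move=> uU; set x := col_mx 0 q.
have -> : (T + V ^t* *m W) + (U - T) + V ^t* *m D = U + V ^t* *m (W + D).
  rewrite (mulmxDr _ W) [RHS]addrA; congr (_ + _).
  by move: (T) (V ^t* *m W) => A B; rewrite [LHS]addrC addrA subrK.
have Ex : V ^t* *m x = - (W ^t* *m x) := ctmx_exactW_col_0mx V P q.
rewrite /house (mul_house_algebra _ _ _ _ uU) Ex.
by congr (_ - _); rewrite (ctmxD W) (mulmxDl (W ^t*)) addKr.
Qed.

(** One column of [V^* Q]: in the expansion given by ctmx_house_col_0mx, each
    term has a small factor, and the others are bounded. *)
Lemma cross_orthogonality_bound (D : 'M[R[i]]_(k0 + m, k0)) (U : 'M[R[i]]_k0)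
    (q : 'cV[R[i]]_m) (xh : 'cV[R[i]]_(k0 + m)) (d dT om e1 e3 eta : R) :
  U \in unitmx -> norm2 D <= om -> norm2 (U - T) <= dT ->
  norm2 (T + V ^t* *m W) <= d -> norm2 V <= Num.sqrt 2 -> 0 <= eta ->
  norm2 (invmx U *m (W + D) ^t*) <= eta ->
  d + dT + Num.sqrt 2 * om <= e1 ->
  normF (xh - house (W + D) U *m col_mx 0 q) <=
    e3 * normF (col_mx 0 q : 'cV_(k0 + m)) ->
  normF (V ^t* *m xh) <=
    (om + e1 * eta + Num.sqrt 2 * e3) * normF (col_mx 0 q : 'cV_(k0 + m)).
Proof.
move=> uU hD hU hd hV eta0 heta he1 hx.
set x := col_mx 0 q in hx *.
have hV' : norm2 (V ^t*) <= Num.sqrt 2 by rewrite norm2_adj.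
have hD' : norm2 (D ^t*) <= om by rewrite norm2_adj.
rewrite -(subrK (house (W + D) U *m x) xh) mulmxDr addrC.
rewrite (ctmx_house_col_0mx D q uU) -/x.
have h1 := normF_mulv_le hD' (lexx (normF x)).
have h2 := normF_mulv_le (norm2D (norm2D hd hU) (norm2M hV' hD))
  (normF_mulv_le heta (lexx (normF x))).
have h3 := normF_mulv_le hV' hx.
apply: le_trans (normFD _ _) _.
apply: le_trans (lerD (normFB _ _) (lexx _)) _.
apply: le_trans (lerD (lerD h1 h2) h3) _.
have h4 := ler_wpM2r (mulr_ge0 eta0 (normF_ge0 x)) he1.
apply: le_trans (lerD (lerD (lexx _) h4) (lexx _)) _.
move: (normF x) (Num.sqrt 2) => y s; clear.
by rewrite !mulrDl !mulrA.
Qed.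

(** The computed triangular factor is not much larger than the factored
    matrix. *)
Lemma norm2_qr_R l (M Q : 'M[R[i]]_(m, l)) (S : 'M[R[i]]_l) (eo er : R) :
  norm2 (Q ^t* *m Q - 1%:M) <= eo -> norm2 (M - Q *m S) <= er * norm2 M ->
  eo <= 1 / 8 -> 0 <= er <= 1 / 8 -> norm2 S <= Num.sqrt 2 * norm2 M.
Proof.
move=> hQ hM heo /andP[er0 her].
apply: norm2_le => [|x]; first by rewrite mulr_ge0 ?sqrtr_ge0 ?norm2_ge0.
apply: normF_le_sqr; first by rewrite !mulr_ge0 ?sqrtr_ge0 ?norm2_ge0 ?normF_ge0.
have [lo _] := andP (normF_near_iso (S *m x) hQ).
have hi : norm2 (Q *m S) <= norm2 M + er * norm2 M.
  have -> : Q *m S = M - (M - Q *m S) by rewrite opprB addrC subrK.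
  exact: norm2B (lexx _) hM.
have hi2 : normF (Q *m (S *m x)) ^+ 2 <= ((norm2 M + er * norm2 M) * normF x) ^+ 2.
  rewrite ler_pXn2r ?nnegrE ?normF_ge0 //; last first.
    by rewrite !mulr_ge0 ?addr_ge0 ?mulr_ge0 ?norm2_ge0 ?normF_ge0.
  by rewrite mulmxA; apply: normF_mulv_le hi (lexx _).
have := le_trans lo hi2; rewrite !exprMn (@sqr_sqrtr R 2) ?ler0n //.
have -> : norm2 M + er * norm2 M = (1 + er) * norm2 M by ring.
rewrite exprMn -(mulrA ((1 + er) ^+ 2)) -(mulrA 2) => h.
exact: qr_ineq (sqr_ge0 _) (mulr_ge0 (sqr_ge0 _) (sqr_ge0 _)) heo er0 her h.
Qed.

End TwoStageBounds.

(** * Residual *)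

(** The numerical estimate that adds up the six terms of the residual. *)
Lemma residual_ineq (R : realFieldType) (a h ka e4 er d2 g q t : R) :
  0 <= a -> 1 <= h -> 0 <= ka -> 0 <= e4 -> 0 <= er -> 0 <= d2 -> 0 <= g ->
  0 <= q -> 0 <= t ->
  a * t + h * (e4 * (ka * t)) + h * d2 * ((h + ka * e4) * t)
    + 2 * q * g * ((h + ka * e4) * t) + h * (er * ((h + ka * e4) * t))
    + 2 * ka * e4 * ((h + ka * e4) * t) <=
  (a + (h + ka * e4) ^+ 2 * (er + d2 + 3 * ka * e4 + 2 * q * g)) * t.
Proof.
move=> a0 h1 ka0 e0 er0 d0 g0 q0 t0.
have ke0 : 0 <= ka * e4 by rewrite mulr_ge0.
have qg0 : 0 <= q * g by rewrite mulr_ge0.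
set H := h + ka * e4.
have hH : h <= H by rewrite /H lerDl.
have H1 : 1 <= H := le_trans h1 hH.
have H0 : 0 <= H := le_trans ler01 H1.
have h0 : 0 <= h := le_trans ler01 h1.
have HH : H <= H ^+ 2 by rewrite expr2 ler_peMr.
have hHH : h * H <= H ^+ 2 by rewrite expr2 ler_wpM2r.
have hH2 : h <= H ^+ 2 := le_trans hH HH.
have b1 := ler_wpM2r ke0 hH2.
have b2 := ler_wpM2r d0 hHH.
have b3 := ler_wpM2r qg0 HH.
have b4 := ler_wpM2r er0 hHH.
have b5 := ler_wpM2r ke0 HH.
have -> : a * t + h * (e4 * (ka * t)) + h * d2 * (H * t) + 2 * q * g * (H * t)
    + h * (er * (H * t)) + 2 * ka * e4 * (H * t) =
    (a + h * (ka * e4) + h * H * d2 + 2 * (H * (q * g)) + h * H * er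
      + 2 * (H * (ka * e4))) * t by ring.
apply: (ler_wpM2r t0).
have -> : a + H ^+ 2 * (er + d2 + 3 * ka * e4 + 2 * q * g) =
    a + H ^+ 2 * (ka * e4) + H ^+ 2 * d2 + 2 * (H ^+ 2 * (q * g)) + H ^+ 2 * er
      + 2 * (H ^+ 2 * (ka * e4)) by ring.
apply: lerD; last by rewrite ler_pM2l.
apply: lerD => //; apply: lerD; last by rewrite ler_pM2l.
by apply: lerD => //; apply: lerD.
Qed.

Section Residual.
Variables (R : realType) (k0 m k : nat).
Variables (V : 'M[R[i]]_(k0 + m, k0)) (P : 'M[R[i]]_k0).
Variables (H : 'M[R[i]]_(k0 + m)) (A Ah Qh : 'M[R[i]]_(k0 + m, k)).
Variables (Qb : 'M[R[i]]_(m, k)) (Rh : 'M[R[i]]_k) (Sh : 'M[R[i]]_(k0, k)).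

Lemma residual_algebra :
  H *m col_mx (usubmx Ah) 0 = V *m (invmx P *m usubmx Ah) ->
  A - Qh *m Rh - V *m Sh =
  - ((H *m H ^t* - 1%:M) *m A) - H *m (Ah - H ^t* *m A)
  + V *m (invmx P - P ^t*) *m usubmx Ah - V *m (Sh - P ^t* *m usubmx Ah)
  + H *m col_mx 0 (dsubmx Ah - Qb *m Rh) - (Qh - H *m col_mx 0 Qb) *m Rh.
Proof.
move=> h.
have EA : H *m Ah = V *m (invmx P *m usubmx Ah) + H *m col_mx 0 (dsubmx Ah).
  by rewrite -h -mulmxDr add_col_mx addr0 add0r vsubmxK.
have EQ : H *m col_mx 0 (dsubmx Ah - Qb *m Rh) =
    H *m col_mx 0 (dsubmx Ah) - H *m col_mx 0 Qb *m Rh.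
  by rewrite -mulmxA mul_col_mx mul0mx -mulmxBr opp_col_mx add_col_mx oppr0 addr0.
rewrite EQ !mulmxBl mul1mx (mulmxBr H) EA !mulmxBr mulmxBl !mulmxA.
move: (H *m _ *m A) (V *m _ *m _) (H *m col_mx 0 (dsubmx Ah)) => X Y Z.
move: (H *m _ *m Rh) (V *m Sh) (Qh *m Rh) (V *m _ *m _) => B C D E.
by apply/matrixP => i j; rewrite !mxE; ring.
Qed.

Lemma residual_bound (a h e4 eo er d2 g : R) :
  0 <= a -> 1 <= h -> 0 <= e4 -> 0 <= g ->
  norm2 V <= Num.sqrt 2 -> norm2 P <= Num.sqrt 2 -> 0 <= d2 ->
  norm2 (V *m (invmx P - P ^t*)) <= h * d2 ->
  H *m col_mx (usubmx Ah) 0 = V *m (invmx P *m usubmx Ah) ->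
  norm2 (H *m H ^t* - 1%:M) <= a -> norm2 H <= h ->
  normF (Ah - H ^t* *m A) <= e4 * normF A ->
  normF (Sh - P ^t* *m usubmx Ah) <= g * (normF (P ^t*) * normF (usubmx Ah)) ->
  eo <= 1 / 8 -> 0 <= er <= 1 / 8 ->
  norm2 (Qb ^t* *m Qb - 1%:M) <= eo -> norm2 Qb <= Num.sqrt 2 ->
  norm2 (dsubmx Ah - Qb *m Rh) <= er * norm2 (dsubmx Ah) ->
  normF (Qh - H *m col_mx 0 Qb) <= e4 * normF Qb ->
  norm2 (A - Qh *m Rh - V *m Sh) <=
    (a + (h + Num.sqrt k%:R * e4) ^+ 2 *
      (er + d2 + 3 * Num.sqrt k%:R * e4 + 2 * k0%:R * g)) * norm2 A.
Proof.
move=> a0 h1 e0 g0 hV hP d0 hVP hH0 hHH hH hA hS heo her hQ hQ2 hR hQh.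
have er0 : 0 <= er by case/andP: her.
have s2 : Num.sqrt 2 * Num.sqrt 2 = 2 :> R by rewrite -expr2 sqr_sqrtr ?ler0n.
have sk0 : Num.sqrt k0%:R * Num.sqrt k0%:R = k0%:R :> R.
  by rewrite -expr2 sqr_sqrtr ?ler0n.
set ka := Num.sqrt k%:R; set t := norm2 A.
have ka0 : 0 <= ka := sqrtr_ge0 _.
have t0 : 0 <= t := norm2_ge0 _.
have hAF : norm2 (Ah - H ^t* *m A) <= e4 * (ka * t).
  apply: le_trans (norm2_le_normF _) _; apply: le_trans hA _.
  by apply: (ler_wpM2l e0); exact: normF_le_cols.
have hAh : norm2 Ah <= (h + ka * e4) * t.
  rewrite -(subrK (H ^t* *m A) Ah) addrC mulrDl.
  have -> : ka * e4 * t = e4 * (ka * t) by ring.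
  apply: norm2D _ hAF; apply: norm2M (lexx _).
  by rewrite norm2_adj.
set z := _ * t in hAh.
have hA1 : norm2 (usubmx Ah) <= z := le_trans (norm2_usubmx Ah) hAh.
have hA2 : norm2 (dsubmx Ah) <= z := le_trans (norm2_dsubmx Ah) hAh.
have hP' : normF (P ^t*) <= Num.sqrt k0%:R * Num.sqrt 2.
  rewrite normF_adj; apply: le_trans (normF_le_cols _) _.
  by apply: ler_wpM2l hP; exact: sqrtr_ge0.
have hA1F : normF (usubmx Ah) <= Num.sqrt k0%:R * z.
  apply: le_trans (normF_le_rows _) _.
  by apply: ler_wpM2l hA1; exact: sqrtr_ge0.
have hS' : norm2 (Sh - P ^t* *m usubmx Ah) <=
    g * (Num.sqrt k0%:R * Num.sqrt 2 * (Num.sqrt k0%:R * z)).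
  apply: le_trans (norm2_le_normF _) _; apply: le_trans hS _.
  apply: (ler_wpM2l g0); exact: ler_pM (normF_ge0 _) (normF_ge0 _) hP' hA1F.
have hR' : norm2 (col_mx (0 : 'M_(k0, k)) (dsubmx Ah - Qb *m Rh)) <= er * z.
  apply: le_trans (norm2_col_0mx _ _) _; apply: le_trans hR _.
  exact: (ler_wpM2l er0).
have hQF : norm2 (Qh - H *m col_mx 0 Qb) <= e4 * (ka * Num.sqrt 2).
  apply: le_trans (norm2_le_normF _) _; apply: le_trans hQh _.
  apply: (ler_wpM2l e0); apply: le_trans (normF_le_cols _) _.
  by apply: (ler_wpM2l ka0).
have hRh : norm2 Rh <= Num.sqrt 2 * z.
  apply: le_trans (norm2_qr_R hQ hR heo her) _.
  by apply: ler_wpM2l hA2; exact: sqrtr_ge0.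
rewrite (residual_algebra hH0).
have b1 : norm2 (- ((H *m H ^t* - 1%:M) *m A)) <= a * t.
  by rewrite norm2N; apply: norm2M hHH (lexx _).
have b2 := norm2M hH hAF.
have b3 := norm2M hVP hA1.
have b4 := norm2M hV hS'.
have b5 := norm2M hH hR'.
have b6 := norm2M hQF hRh.
apply: le_trans (norm2B (norm2D (norm2B (norm2D (norm2B b1 b2) b3) b4) b5) b6) _.
apply: le_trans (residual_ineq a0 h1 ka0 e0 er0 d0 g0 (ler0n _ k0) t0).
rewrite -/z.
have -> : Num.sqrt 2 * (g * (Num.sqrt k0%:R * Num.sqrt 2 * (Num.sqrt k0%:R * z))) =
    2 * k0%:R * g * z.
  by move: (Num.sqrt 2) (Num.sqrt k0%:R) s2 sk0 => s q <- <-; ring.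
have -> : e4 * (ka * Num.sqrt 2) * (Num.sqrt 2 * z) = 2 * ka * e4 * z.
  by move: (Num.sqrt 2) s2 => s <-; ring.
by [].
Qed.

End Residual.

(** * Norm bounds for the data *)

Lemma V_invP_ineq (R : rcfType) (d1 d2 t y : R) :
  0 <= d1 -> 0 <= d2 -> d1 <= 1 / 8 -> d2 <= 1 / 8 ->
  d2 <= 3 * t * d2 -> 4 * t <= y ->
  Num.sqrt (1 + d1) * (d2 * (Num.sqrt (1 - d2))^-1) <=
    Num.sqrt (1 + (d1 + d2) * y) * d2.
Proof.
move=> d10 d20 h1 h2 ht hy.
have [->|d2n] := eqVneq d2 0; first by rewrite mul0r !mulr0.
have d2p : 0 < d2 by rewrite lt_def d2n.
have t3 : 1 <= 3 * t by rewrite -(ler_pM2r d2p) mul1r.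
have y43 : 4 / 3 <= y by lra.
have s0 : 0 < 1 - d2 by lra.
rewrite mulrCA [leRHS]mulrC ler_pM2l // ler_pdivrMr ?sqrtr_gt0 //.
rewrite -sqrtrM; last by rewrite addr_ge0 // mulr_ge0 //; lra.
apply: ler_wsqrtr.
have k1 : (d1 + d2) * (4 / 3) <= (d1 + d2) * y by rewrite ler_wpM2l // addr_ge0.
have k2 : (1 + (d1 + d2) * (4 / 3)) * (1 - d2) <= (1 + (d1 + d2) * y) * (1 - d2).
  by rewrite ler_pM2r // lerD2l.
apply: le_trans k2.
have k3 := mulr_ge0 d10 d20.
nra.
Qed.

Section Data.
Variables (R : realType) (k0 m : nat).
Variables (V : 'M[R[i]]_(k0 + m, k0)) (P : 'M[R[i]]_k0) (d1 d2 : R).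
Hypotheses (hV : norm2 (V ^t* *m V - 1%:M) <= d1)
           (hP : norm2 (P ^t* *m P - 1%:M) <= d2).
Hypotheses (d1_ge0 : 0 <= d1) (d2_ge0 : 0 <= d2).
Hypotheses (d1_le : d1 <= 1 / 8) (d2_le : d2 <= 1 / 8).

Lemma norm2_le_sqrt2 l p (M : 'M[R[i]]_(l, p)) (d : R) : d <= 1 / 8 ->
  norm2 (M ^t* *m M - 1%:M) <= d -> norm2 M <= Num.sqrt 2.
Proof.
move=> hd h; apply: norm2_near_iso h (sqrtr_ge0 _) _.
by rewrite sqr_sqrtr ?ler0n //; move: hd; lra.
Qed.

Lemma norm2_exactT : norm2 (exactT V P) <= 3.
Proof.
pose s : R := Num.sqrt (3 / 2).
have s0 : 0 <= s := sqrtr_ge0 _.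
have s2 : s ^+ 2 = 3 / 2 by rewrite sqr_sqrtr //; lra.
have hVs : norm2 V <= s.
  by apply: norm2_near_iso hV s0 _; rewrite s2; move: d1_le; lra.
have hPs : norm2 P <= s.
  by apply: norm2_near_iso hP s0 _; rewrite s2; move: d2_le; lra.
have hPV := norm2B hPs (le_trans (norm2_usubmx V) hVs).
have -> : 3 = (s + s) * s.
  have -> : (s + s) * s = 2 * s ^+ 2 by ring.
  by rewrite s2; field.
by rewrite /exactT; apply: norm2M hPs; rewrite norm2_adj.
Qed.

Lemma norm2_exactW : norm2 (exactW V P) <= 2 * Num.sqrt 2.
Proof.
rewrite mulrDl mul1r; apply: norm2B (norm2_le_sqrt2 d1_le hV).
exact: le_trans (norm2_col_mx0 _ _) (norm2_le_sqrt2 d2_le hP).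
Qed.

Lemma normF_exactW : normF (exactW V P) <= 2 * Num.sqrt (2 * k0%:R).
Proof.
apply: le_trans (normF_le_cols _) _; rewrite sqrtrM ?ler0n // mulrA mulrC.
by apply: ler_wpM2r norm2_exactW; exact: sqrtr_ge0.
Qed.

Lemma norm2_gram_exactW :
  norm2 ((exactW V P) ^t* *m exactW V P - (exactT V P + (exactT V P) ^t*)) <= d1 + d2.
Proof. by rewrite gram_exactW; exact: norm2B. Qed.

Lemma norm2_exactT_addW :
  norm2 (exactT V P + V ^t* *m exactW V P) <= d1 + d2.
Proof. by rewrite exactT_addW [d1 + d2]addrC; exact: norm2B. Qed.

Lemma norm2_inv_near_iso : P \in unitmx ->
  norm2 (invmx P) <= (Num.sqrt (1 - d2))^-1.
Proof.
move=> uP; have d20 : 0 < 1 - d2 by move: d2_le; lra.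
have q0 : 0 < Num.sqrt (1 - d2) by rewrite sqrtr_gt0.
apply: norm2_le => [|x]; first by rewrite invr_ge0 ltW.
rewrite -(ler_pM2l q0) mulVKf ?gt_eqF // -(@ler_pXn2r _ 2) ?nnegrE //; last first.
- exact: normF_ge0.
- by rewrite mulr_ge0 ?normF_ge0 // ltW.
rewrite exprMn (@sqr_sqrtr R _ (ltW d20)).
have /andP[h _] := normF_near_iso (invmx P *m x) hP; move: h; by rewrite (mulKVmx uP).
Qed.

(** [V P^-1] and [V P^*] differ by little more than [P^* P] differs from the
    identity; the factor exceeding 1 is absorbed using [‖T^-1‖ >= 1/3], which
    holds unless [P^* P] is the identity. *)
Lemma norm2_V_invP (eta : R) : exactT V P \in unitmx ->
  d2 <= norm2 (P ^t* *m P - 1%:M) ->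
  4 * norm2 (invmx (exactT V P)) <= eta ^+ 2 ->
  norm2 (V *m (invmx P - P ^t*)) <= Num.sqrt (1 + (d1 + d2) * eta ^+ 2) * d2.
Proof.
move=> uT hd2 heta; have uP := exactT_unit_P uT.
have -> : V *m (invmx P - P ^t*) = V *m (- (P ^t* *m P - 1%:M) *m invmx P).
  by rewrite opprB mulmxBl mul1mx mulmxK.
have hV' : norm2 V <= Num.sqrt (1 + d1).
  by apply: norm2_near_iso hV (sqrtr_ge0 _) _; rewrite sqr_sqrtr // addr_ge0.
have hP' : norm2 (- (P ^t* *m P - 1%:M)) <= d2 by rewrite norm2N.
apply: le_trans (norm2M hV' (norm2M hP' (norm2_inv_near_iso uP))) _.
have h3 : d2 <= 3 * norm2 (invmx (exactT V P)) * d2.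
  apply: le_trans hd2 _.
  have {1}-> : P ^t* *m P - 1%:M =
      exactT V P *m invmx (exactT V P) *m (P ^t* *m P - 1%:M).
    by rewrite (mulmxV uT) mul1mx.
  exact: norm2M (norm2M norm2_exactT (lexx _)) hP.
exact: V_invP_ineq d1_ge0 d2_ge0 d1_le d2_le h3 heta.
Qed.

End Data.

(** * The error bounds of the two-stage algorithm *)

Lemma col_subM (K : pzRingType) l n p (M : 'M[K]_(l, p)) (N : 'M[K]_(l, n))
    (X : 'M[K]_(n, p)) j : col j (M - N *m X) = col j M - N *m col j X.
Proof. by rewrite !colE mulmxBl -mulmxA. Qed.

(** The three bounds, with the constants given by equations. *)
Lemma two_stage_bounds (R : realType) (u eo er eT esv : R) (k0 m k : nat)
    (V : 'M[R[i]]_(k0 + m, k0)) (A : 'M[R[i]]_(k0 + m, k)) (P : 'M[R[i]]_k0)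
    (Qh : 'M[R[i]]_(k0 + m, k)) (Rh : 'M[R[i]]_k) (Sh : 'M[R[i]]_(k0, k))
    (t d1 d2 d dT wF om e1 eta e2 e3 : R) :
  t = norm2 (invmx (exactT V P)) ->
  0 <= u < 1 -> 0 <= eo <= 1 / 8 -> 0 <= er <= 1 / 8 -> 0 <= eT -> 0 <= esv ->
  fl_two_stage u eo er eT esv V A P Qh Rh Sh ->
  exactT V P \in unitmx ->
  d1 = norm2 (V ^t* *m V - 1%:M) -> d2 = norm2 (P ^t* *m P - 1%:M) ->
  d1 <= 1 / 8 -> d2 <= 1 / 8 -> d = d1 + d2 ->
  dT = eT + 3 * esv * (1 + eT) -> dT * t <= 1 / 2 ->
  wF = 2 * Num.sqrt (2 * k0%:R) -> om = wF * gamma u (k0 + 1) ->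
  d + 2 * dT + 2 * (2 * Num.sqrt 2) * om + om ^+ 2 = e1 ->
  0 <= eta -> 4 * t + 4 * t ^+ 2 * e1 <= eta ^+ 2 ->
  e2 = (dT + om ^+ 2) * eta ^+ 2 + 2 * om * eta ->
  e3 = wF * gamma u (k0 + m + 2 * k0 + 1) * eta
    + u * (Num.sqrt (1 + d * eta ^+ 2) + e2) ->
  [/\ norm2 (Qh ^t* *m Qh - 1%:M) <=
        eo + 2 * (d * eta ^+ 2
          + 2 * Num.sqrt (k%:R * (1 + d * eta ^+ 2)) * (e2 + e3)
          + k%:R * (e2 + e3) ^+ 2),
      normF (V ^t* *m Qh) <=
        (om + e1 * eta + Num.sqrt 2 * e3) * (Num.sqrt k%:R * Num.sqrt 2),
      norm2 (A - Qh *m Rh - V *m Sh) <=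
        (d * eta ^+ 2
        + (Num.sqrt (1 + d * eta ^+ 2) + Num.sqrt k%:R * (e2 + e3)) ^+ 2
          * (er + d2 + 3 * Num.sqrt k%:R * (e2 + e3)
             + 2 * k0%:R * gamma u k0)) * norm2 A,
      0 <= e2 & 0 <= e3].
Proof.
move=> Et u01 /andP[eo0 heo] her eT0 esv0 [Wh [Th [Ah [Qb hfl]]]].
have [hWh [hTh [hAh [hSh [[hQb hRes] hQh]]]]] := hfl.
move=> uT Ed1 Ed2 hd1 hd2 Ed EdT hdT EwF Eom Ee1 eta0 heta Ee2 Ee3.
have u0 : 0 <= u by case/andP: u01.
have hV : norm2 (V ^t* *m V - 1%:M) <= d1 by rewrite Ed1.
have hP : norm2 (P ^t* *m P - 1%:M) <= d2 by rewrite Ed2.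
have d10 : 0 <= d1 by rewrite Ed1 norm2_ge0.
have d20 : 0 <= d2 by rewrite Ed2 norm2_ge0.
have d0 : 0 <= d by rewrite Ed addr_ge0.
have hV2 := norm2_le_sqrt2 hd1 hV.
have hP2 := norm2_le_sqrt2 hd2 hP.
have hQ2 := norm2_le_sqrt2 heo hQb.
have [W EW] : exists W, W = exactW V P by exists (exactW V P).
have [T ET] : exists T, T = exactT V P by exists (exactT V P).
rewrite -ET in Et uT hTh.
have hW : norm2 W <= 2 * Num.sqrt 2 by rewrite EW; exact: norm2_exactW hV hP hd1 hd2.
have hWF : normF W <= wF by rewrite EwF EW; exact: normF_exactW hV hP hd1 hd2.
have hT3 : norm2 T <= 3 by rewrite ET; exact: norm2_exactT hV hP hd1 hd2.
have hE : norm2 (W ^t* *m W - (T + T ^t*)) <= d.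
  by rewrite Ed ET EW; exact: norm2_gram_exactW.
have hTW : norm2 (T + V ^t* *m W) <= d by rewrite Ed ET EW; exact: norm2_exactT_addW.
have hWr : relmx u 1 W Wh by rewrite EW /exactW; apply: fl_submx_relmx.
have uT' : T ^t* \in unitmx by rewrite ctmx_unit.
have hE' : norm2 (W ^t* *m W - (T ^t* + (T ^t*) ^t*)) <= d.
  rewrite (ctmxK T) (addrC (T ^t*)).
  exact: hE.
have Et' : t = norm2 (invmx (T ^t*)) by rewrite norm2_inv_adj.
have hT3' : norm2 (T ^t*) <= 3 by rewrite norm2_adj.
have hTh' : norm2 (Th ^t* - T ^t*) <= eT by rewrite norm2_adjB.
have le_k0 : (k0 <= k0 + m)%N := leq_addr _ _.
have wF0 : k0 = 0%N -> wF = 0 by move=> k00; rewrite EwF k00 mulr0 sqrtr0 mulr0.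
have wF_ge0 : 0 <= wF by rewrite EwF mulr_ge0 // sqrtr_ge0.
have om0 : 0 <= om by rewrite Eom mulr_ge0 // gamma_ge0.
have dT0 : 0 <= dT by rewrite EdT addr_ge0 // !mulr_ge0 // addr_ge0.
have e20 : 0 <= e2.
  by rewrite Ee2 addr_ge0 // mulr_ge0 ?sqr_ge0 ?mulr_ge0 // addr_ge0 ?sqr_ge0.
have e30 : 0 <= e3.
  by rewrite Ee3 addr_ge0 // mulr_ge0 ?addr_ge0 ?sqrtr_ge0 ?mulr_ge0 // gamma_ge0.
have e40 : 0 <= e2 + e3 := addr_ge0 e20 e30.
have hle1 : d + 2 * dT + 2 * (2 * Num.sqrt 2) * om + om ^+ 2 <= e1 by rewrite Ee1.
have sq2 : 0 <= Num.sqrt 2 :> R := sqrtr_ge0 _.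
have le_d_e1 : d <= e1.
  by rewrite -Ee1 -!addrA lerDl !addr_ge0 ?sqr_ge0 // !mulr_ge0.
have heta1 := heta; rewrite Et in heta1.
pose H := house W T.
have stepA : normF (Ah - H ^t* *m A) <= (e2 + e3) * normF A.
  apply: normF_cols_le e40 _ => j; rewrite /H house_adj.
  have := fl_apply_forward u01 uT' d0 hE' eta0 _ hW hWF eT0 esv0 _ _
    hT3' hTh' hWr le_k0 wF0 (hAh j).
  rewrite -Et' -EdT -Eom -Ee2 -Ee3 => /(_ _ heta hle1 hdT).
  by rewrite col_subM.
have stepQ : normF (Qh - H *m col_mx 0 Qb) <= (e2 + e3) * normF Qb.
  rewrite -[normF Qb](normF_col_0mx k0).
  apply: normF_cols_le e40 _ => j.
  have := fl_apply_forward u01 uT d0 hE eta0 _ hW hWF eT0 esv0 _ _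
    hT3 hTh hWr le_k0 wF0 (hQh j).
  rewrite -Et -EdT -Eom -Ee2 -Ee3 => /(_ _ heta hle1 hdT).
  by rewrite col_subM.
have hX : norm2 (col_mx (0 : 'M_(k0, k)) Qb) <= Num.sqrt 2.
  exact: le_trans (norm2_col_0mx _ _) hQ2.
have hXX : norm2 ((col_mx (0 : 'M_(k0, k)) Qb) ^t* *m col_mx 0 Qb - 1%:M) <= eo.
  by rewrite mul_ctmx_col_0mx col_mxKd.
have deta0 : 0 <= d * eta ^+ 2 by rewrite mulr_ge0 // sqr_ge0.
have hHn : norm2 H <= Num.sqrt (1 + d * eta ^+ 2).
  exact: (norm2_house uT d0 le_d_e1 hE eta0 heta1).
split=> //.
- apply: (orthogonality_bound deta0 e40 hXX hX _ hHn).
    exact: (house_near_unitary uT d0 le_d_e1 hE eta0 heta1).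
  by rewrite normF_col_0mx.
- have e10 : 0 <= e1 := le_trans d0 le_d_e1.
  have c0 : 0 <= om + e1 * eta + Num.sqrt 2 * e3.
    by rewrite !addr_ge0 ?mulr_ge0.
  apply: le_trans (_ : _ <= (om + e1 * eta + Num.sqrt 2 * e3) *
    normF (col_mx (0 : 'M_(k0, k)) Qb)) _; last first.
    apply: (ler_wpM2l c0); apply: le_trans (normF_le_cols _) _.
    by apply: (ler_wpM2l (sqrtr_ge0 _)).
  apply: normF_cols_le c0 _ => j.
  have := fl_apply_house u01 uT d0 hE eta0 _ hW hWF eT0 esv0 _ _
    hT3 hTh hWr le_k0 wF0 (hQh j).
  rewrite -Et -EdT -Eom -Ee2 -Ee3 => /(_ _ heta hle1 hdT) [D [U [hD hU hx]]].
  rewrite Et in hdT.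
  have uU := house_perturbed_unit uT hU hdT.
  have hiW := norm2_perturbed_inv_W uT hE eta0 heta1 hW hD hU hle1 hdT.
  have hc : d + dT + Num.sqrt 2 * om <= e1.
    rewrite -Ee1 -[leRHS]addrA; apply: lerD.
      by rewrite lerD2l ler_peMl // ler1n.
    apply: ler_wpDr (sqr_ge0 _) _; apply: (ler_wpM2r om0).
    by rewrite mulrA ler_peMl // -natrM ler1n.
  rewrite colE -mulmxA -colE col_col_mx raddf0.
  rewrite col_col_mx raddf0 in hx.
  rewrite EW in hx hiW hTW; rewrite ET in hU hTW.
  exact: cross_orthogonality_bound uU hD hU hTW hV2 eta0 hiW hc hx.
- have hHH : norm2 (H *m H ^t* - 1%:M) <= d * eta ^+ 2.
    rewrite Et' in heta.
    have := house_near_unitary uT' d0 le_d_e1 hE' eta0 heta.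
    by rewrite -house_adj (ctmxK H).
  have h1 : 1 <= Num.sqrt (1 + d * eta ^+ 2).
    by rewrite -[leLHS]sqrtr1; apply: ler_wsqrtr; rewrite lerDl.
  have hVP : norm2 (V *m (invmx P - P ^t*)) <= Num.sqrt (1 + d * eta ^+ 2) * d2.
    have hd2' : d2 <= norm2 (P ^t* *m P - 1%:M) by rewrite Ed2.
    have heta4 : 4 * norm2 (invmx (exactT V P)) <= eta ^+ 2.
      rewrite -ET; apply: le_trans heta1; rewrite lerDl.
      apply: mulr_ge0 _ (le_trans d0 le_d_e1); apply: mulr_ge0 (sqr_ge0 _).
      exact: ler0n.
    rewrite Ed; rewrite ET in uT.
    exact (norm2_V_invP hV hP d10 d20 hd1 hd2 uT hd2' heta4).
  have hH0 : H *m col_mx (usubmx Ah) 0 = V *m (invmx P *m usubmx Ah).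
    by rewrite /H EW ET; apply: house_col_mx0; rewrite -ET.
  exact: residual_bound deta0 h1 e40 (gamma_ge0 u01 k0) hV2 hP2 d20 hVP hH0 hHH
    hHn stepA (fl_mulmx_forward u01 hSh) heo her hQb hQ2 hRes stepQ.
Qed.

Theorem theorem3 (R : realType) :
  exists c : R, 0 < c /\
  forall (u : R) (eps_orth eps_res : R -> nat -> nat -> R)
    (eps_T eps_sv : R -> nat -> R) (k0 m k : nat)
    (V : 'M[R[i]]_(k0 + m, k0)) (A : 'M[R[i]]_(k0 + m, k)) (P : 'M[R[i]]_k0)
    (Qh : 'M[R[i]]_(k0 + m, k)) (Rh : 'M[R[i]]_k) (Sh : 'M[R[i]]_(k0, k)),
  let n := (k0 + m)%N in
  let T := exactT V P in
  let nTinv := norm2 (invmx T) in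
  let delta1 := norm2 (V ^t* *m V - 1%:M) in
  let delta2 := norm2 (P ^t* *m P - 1%:M) in
  let deltaT := eps_T u k0 + 3 * eps_sv u k0 * (1 + eps_T u k0) in
  let delta := delta1 + delta2 in
  let eps1 := delta + 2 * deltaT
    + 16 * Num.sqrt k0%:R * gamma u (k0 + 1)
    + 8 * k0%:R * gamma u (k0 + 1) ^+ 2 in
  let eta := 2 * Num.sqrt (nTinv ^+ 2 * eps1 + nTinv) in
  let eps2 := (deltaT + 8 * k0%:R * gamma u (k0 + 1) ^+ 2) * eta ^+ 2
    + 4 * Num.sqrt (2 * k0%:R) * gamma u (k0 + 1) * eta in
  let eps3 := 2 * Num.sqrt (2 * k0%:R) * gamma u (n + 2 * k0 + 1) * eta
    + u * (Num.sqrt (1 + delta * eta ^+ 2) + eps2) in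
  let eps4 := eps2 + eps3 in
  0 <= u < 1 ->
  (k0 + k <= n)%N ->
  0 <= eps_orth u (n - k0)%N k <= c ->
  0 <= eps_res u (n - k0)%N k <= c ->
  0 <= eps_T u k0 -> 0 <= eps_sv u k0 ->
  fl_two_stage u (eps_orth u (n - k0)%N k) (eps_res u (n - k0)%N k)
    (eps_T u k0) (eps_sv u k0) V A P Qh Rh Sh ->
  T \in unitmx ->
  delta1 <= c -> delta2 <= c ->
  deltaT * nTinv <= 1 / 2 ->
  [/\ norm2 (Qh ^t* *m Qh - 1%:M) <=
        eps_orth u (n - k0)%N k
        + 2 * (delta * eta ^+ 2
               + 2 * Num.sqrt (k%:R * (1 + delta * eta ^+ 2)) * eps4
               + k%:R * eps4 ^+ 2),
      normF (V ^t* *m Qh) <=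
        Num.sqrt (2 * k%:R)
        * (2 * Num.sqrt (2 * k0%:R) * gamma u (k0 + 1)
           + eps1 * eta + Num.sqrt 2 * eps3) &
      norm2 (A - Qh *m Rh - V *m Sh) / norm2 A <=
        delta * eta ^+ 2
        + (Num.sqrt (1 + delta * eta ^+ 2) + Num.sqrt k%:R * eps4) ^+ 2
          * (eps_res u (n - k0)%N k + delta2 + 3 * Num.sqrt k%:R * eps4
             + 2 * k0%:R * gamma u k0)].
Proof.
exists (1 / 8); split; first by rewrite divr_gt0.
move=> u eps_orth eps_res eps_T eps_sv k0 m k V A P Qh Rh Sh n T nTinv delta1
  delta2 deltaT delta eps1 eta eps2 eps3 eps4 u01 _ ho hr hT0 hs0 hfl uT hd1 hd2 hdT.
have s2 : Num.sqrt 2 * Num.sqrt 2 = 2 :> R by rewrite -expr2 sqr_sqrtr ?ler0n.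
have sk : Num.sqrt k0%:R * Num.sqrt k0%:R = k0%:R :> R.
  by rewrite -expr2 sqr_sqrtr ?ler0n.
have s2k : Num.sqrt (2 * k0%:R) = Num.sqrt 2 * Num.sqrt k0%:R :> R.
  by rewrite sqrtrM ?ler0n.
have s2k2 : (2 * Num.sqrt (2 * k0%:R)) ^+ 2 = 8 * k0%:R :> R.
  by rewrite exprMn sqr_sqrtr ?mulr_ge0 //; ring.
pose om := 2 * Num.sqrt (2 * k0%:R) * gamma u (k0 + 1).
have Eom2 : om ^+ 2 = 8 * k0%:R * gamma u (k0 + 1) ^+ 2.
  by rewrite exprMn s2k2.
have Ee1 : delta + 2 * deltaT + 2 * (2 * Num.sqrt 2) * om + om ^+ 2 = eps1.
  rewrite Eom2 /eps1; congr (_ + _ + _); rewrite /om s2k.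
  move: (Num.sqrt 2) (Num.sqrt k0%:R) (gamma u (k0 + 1)) s2 => s q g hs.
  have -> : 2 * (2 * s) * (2 * (s * q) * g) = 8 * (s * s) * q * g by ring.
  by rewrite hs; ring.
have nT0 : 0 <= nTinv := norm2_ge0 _.
have d0 : 0 <= delta by rewrite addr_ge0 ?norm2_ge0.
have dT0 : 0 <= deltaT by rewrite addr_ge0 ?mulr_ge0 ?addr_ge0.
have om0 : 0 <= om by rewrite mulr_ge0 ?gamma_ge0 ?mulr_ge0 ?sqrtr_ge0.
have e10 : 0 <= eps1.
  have c0 : 0 <= 2 * (2 * Num.sqrt 2) :> R by rewrite !mulr_ge0 ?sqrtr_ge0.
  rewrite -Ee1.
  exact (addr_ge0 (addr_ge0 (addr_ge0 d0 (mulr_ge0 (ler0n _ 2) dT0))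
    (mulr_ge0 c0 om0)) (sqr_ge0 om)).
have Eeta : 4 * nTinv + 4 * nTinv ^+ 2 * eps1 <= eta ^+ 2.
  rewrite exprMn sqr_sqrtr ?addr_ge0 ?mulr_ge0 ?sqr_ge0 //.
  by rewrite le_eqVlt; apply/orP; left; apply/eqP; ring.
have Ee2 : eps2 = (deltaT + om ^+ 2) * eta ^+ 2 + 2 * om * eta.
  rewrite Eom2 /eps2 /om; congr (_ + _).
  by move: (Num.sqrt (2 * _)) (gamma _ _) (eta) => s g y; ring.
have eta0 : 0 <= eta by rewrite mulr_ge0 ?sqrtr_ge0.
have [b1 b2 b3 e20 e30] := two_stage_bounds (erefl nTinv) u01 ho hr hT0 hs0 hfl uT
  (erefl delta1) (erefl delta2) hd1 hd2 (erefl delta) (erefl deltaT) hdT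
  (erefl _) (erefl om) Ee1 eta0 Eeta Ee2 (erefl eps3).
split.
- exact: b1.
- apply: le_trans b2 _; rewrite mulrC [Num.sqrt (2 * k%:R)]sqrtrM ?ler0n //.
  by rewrite [Num.sqrt k%:R * _]mulrC.
have [A0|A0] := eqVneq (norm2 A) 0.
  rewrite A0 invr0 mulr0.
  have e40 : 0 <= eps4 := addr_ge0 e20 e30.
  have hr0 : 0 <= eps_res u (n - k0)%N k by case/andP: hr.
  exact (addr_ge0 (mulr_ge0 d0 (sqr_ge0 eta)) (mulr_ge0 (sqr_ge0 _)
    (addr_ge0 (addr_ge0 (addr_ge0 hr0 (norm2_ge0 _))
      (mulr_ge0 (mulr_ge0 (ler0n _ 3) (sqrtr_ge0 _)) e40))
      (mulr_ge0 (mulr_ge0 (ler0n _ 2) (ler0n _ k0)) (gamma_ge0 u01 k0))))).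
by rewrite ler_pdivrMr // lt_def A0 norm2_ge0.
Qed.
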